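(* Assume $V$ satisfies (U), and let $\bar v<1$, $c_0$, $s_0$, $\bar\delta$, the modified coefficients and the center manifolds $\mathcal I_\varepsilon=\{(r,u,h_\varepsilon(r,u))\}$, $\varepsilon\in(0,\varepsilon_0]$, be as in the context. Then there exists $\varepsilon_1>0$, depending only on $\bar v$, such that for every $\varepsilon\in(0,\varepsilon_1]$, every solution of the effective equation starting at a point $(r,u,h_\varepsilon(r,u))\in\mathcal I_\varepsilon$ with $|u|\le\bar v$ never reaches the set $\{(r,u,h_\varepsilon(r,u)):|u|=1-\bar\delta\}$ for any future time. In particular such solutions exist globally forward in time.
   Context: $V\in C^3(\mathbb{R}^3)$ with (U): $\inf V>-\infty$, $\sup(|V|+|\nabla V|+|\nabla^2V|+|\nabla^3V|)<\infty$. $\rho\in C_0^\infty$ radial, $\mathsf e=\int\rho\neq0$, $\hat\rho(k)=(2\pi)^{-3/2}\int\rho e^{-ik\cdot x}$. For $|u|<1$: $\gamma=(1-|u|^2)^{-1/2}$, $m_0(u)w=\gamma w+\gamma^3(u\cdot w)u$, $m_e=\frac13\int|\hat\rho|^2|k|^{-2}dk$, $\varphi(s)=\frac{1}{2s^2(1-s^2)}-\frac{1}{4s^3}\log\frac{1+s}{1-s}$, $m_f(u)w=3m_e(\varphi(|u|)w+|u|^{-1}\varphi'(|u|)(u\cdot w)u)$, $m=m_0+m_f$, $a(u)w=\frac{\mathsf e^2}{12\pi}[\gamma^4w+4\gamma^6(u\cdot w)u]$, $b(u,w)=\frac{\mathsf e^2}{4\pi}[2\gamma^6(u\cdot w)w+\gamma^6|w|^2u+6\gamma^8(u\cdot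 w)^2u]$, $\mathcal E_s(u)=\gamma-1+3m_e[\frac{2-|u|^2}{2(1-|u|^2)}-\frac{1}{2|u|}\log\frac{1+|u|}{1-|u|}]$, $H(r,u)=\mathcal E_s(u)+V(r)$. Effective equation: $\dot r=u$, $m(u)\dot u=-\nabla V(r)+\varepsilon a(u)\ddot u+\varepsilon b(u,\dot u)$. Given $\bar v<1$, choose $c_0\in\mathbb{R}$ with $\{(r,u):|u|\le\bar v\}\subset\{H\le c_0\}$, put $s_0=\sup\{|u|:H(r,u)\le c_0+1\text{ for some }r\}<1$ and $\bar\delta=\min\{(1-\bar v)/2,(1-s_0)/2\}$. Modify $a,m,b$ on $1-\bar\delta<|u|<1$ by continuing them with their values at $|u|=1-\bar\delta$ (i.e. replacing $u$ by $(1-\bar\delta)u/|u|$). With $x=(r,u)$, $y=\dot u$ the (modified) effective equation is $\dot x=(u,y)$, $\varepsilon\dot y=a(u)^{-1}[m(u)y+\nabla V(r)-\varepsilon b(u,y)]$; the manifold $\{m(u)y=-\nabla V(r)\}$ is invariant for $\varepsilon=0$ and normally repulsive. Geometric singular perturbation theory provides $\varepsilon_0=\varepsilon_0(\bar\delta)>0$ and $C^1$ functions $h_\varepsilon:\mathbb{R}^3\times\{|u|<1\}\to\mathbb{R}^3$, $\varepsilon\in(0,\varepsilon_0]$, with $\sup|h_\varepsilon|\le c(\bar\delta)$ uniformly in $\varepsilon$, such that $\mathcal I_\varepsilon=\{(r,u,h_\varepsilon(r,u))\}$ is forward invariant for the modified system; while $|u|<1-\bar\delta$ the modified system coincides with the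 effective equation. *)

(* Defs.v *)
From HB Require Import structures.
From mathcomp Require Import all_boot all_order all_algebra.
From mathcomp Require Import all_classical all_reals all_analysis.
Set Implicit Arguments. Unset Strict Implicit. Unset Printing Implicit Defensive.
Import Order.TTheory GRing.Theory Num.Theory.
Import numFieldNormedType.Exports.
Local Open Scope classical_set_scope.
Local Open Scope ring_scope.

Section AbrahamDefs.
Variable R : realType.

Definition vec := 'rV[R]_3.
Definition ev (i : 'I_3) : vec := delta_mx 0 i.
Definition vec3 (x y z : R) : vec := \row_(i < 3) [:: x; y; z]`_i.
Definition dot (u w : vec) : R := \sum_i u 0 i * w 0 i.
Definition enorm (u : vec) : R := Num.sqrt (dot u u).

Definition pd (i : 'I_3) (f : vec -> R) : vec -> R := fun x => 'D_(ev i) f x.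
Definition iter_pd (s : seq 'I_3) (f : vec -> R) : vec -> R :=
  foldr (fun i g => pd i g) f s.
Definition Ck (k : nat) (f : vec -> R) : Prop :=
  forall s : seq 'I_3, (size s <= k)%N ->
    continuous (iter_pd s f) /\
    ((size s < k)%N -> forall (i : 'I_3) (x : vec), derivable (iter_pd s f) x (ev i)).
Definition smooth3 (f : vec -> R) : Prop := forall k, Ck k f.
Definition compact_support (f : vec -> R) : Prop :=
  exists M : R, forall x, M < enorm x -> f x = 0.
Definition radial (f : vec -> R) : Prop :=
  forall x y, enorm x = enorm y -> f x = f y.

Definition Rint (f : R -> R) : R := Rintegral (@lebesgue_measure R) setT f.
Definition int3 (F : vec -> R) : R :=
  Rint (fun x => Rint (fun y => Rint (fun z => F (vec3 x y z)))).

Definition rho_int (rho : vec -> R) : R := int3 rho.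
(* |rho^(k)|^2, rho^(k) = (2 pi)^{-3/2} \int rho(x) e^{-i k.x} dx *)
Definition rhohat_sq (rho : vec -> R) (k : vec) : R :=
  (2 * pi)^-3 * ((int3 (fun x => rho x * cos (dot k x))) ^+ 2
                + (int3 (fun x => rho x * sin (dot k x))) ^+ 2).
Definition m_e (rho : vec -> R) : R :=
  fine (\int[@lebesgue_measure R]_x \int[@lebesgue_measure R]_y
         \int[@lebesgue_measure R]_z
          ((rhohat_sq rho (vec3 x y z)) / (enorm (vec3 x y z)) ^+ 2)%:E)%E / 3.

Definition gamma (u : vec) : R := (Num.sqrt (1 - enorm u ^+ 2))^-1.

(* phi, with its removable singularity at 0 filled by continuity (phi(0)=1/3) *)
Definition phi (s : R) : R :=
  if s == 0 then 1 / 3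
  else (2 * s ^+ 2 * (1 - s ^+ 2))^-1 - (4 * s ^+ 3)^-1 * ln ((1 + s) / (1 - s)).

(* E_s, with its removable singularity at u = 0 filled by continuity *)
Definition Es (me : R) (u : vec) : R :=
  let s := enorm u in
  gamma u - 1 + 3 * me *
    (if s == 0 then 0
     else (2 - s ^+ 2) / (2 * (1 - s ^+ 2)) - (2 * s)^-1 * ln ((1 + s) / (1 - s))).

Definition Ham (me : R) (V : vec -> R) (r u : vec) : R := Es me u + V r.

(* u^T u : w *m outer u = (u.w) u *)
Definition outer (u : vec) : 'M[R]_3 := u^T *m u.

(* the (symmetric) linear maps m_0(u), m_f(u), m(u), a(u), acting w |-> w *m M *)
Definition m0 (u : vec) : 'M[R]_3 := (gamma u)%:M + (gamma u ^+ 3) *: outer u.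
Definition mf (me : R) (u : vec) : 'M[R]_3 :=
  (3 * me) *: ((phi (enorm u))%:M + ((enorm u)^-1 * derive1 phi (enorm u)) *: outer u).
Definition mm (me : R) (u : vec) : 'M[R]_3 := m0 u + mf me u.
Definition aa (e : R) (u : vec) : 'M[R]_3 :=
  (e ^+ 2 / (12 * pi)) *: ((gamma u ^+ 4)%:M + (4 * gamma u ^+ 6) *: outer u).
Definition bb (e : R) (u w : vec) : vec :=
  (e ^+ 2 / (4 * pi)) *:
    ((2 * gamma u ^+ 6 * dot u w) *: w + (gamma u ^+ 6 * dot w w) *: u
     + (6 * gamma u ^+ 8 * (dot u w) ^+ 2) *: u).

Definition grad (V : vec -> R) (r : vec) : vec := \row_i pd i V r.

(* continuation of a coefficient with its value at |u| = 1 - d *)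
Definition clip (d : R) (u : vec) : vec :=
  if enorm u <= 1 - d then u else ((1 - d) / enorm u) *: u.

Definition s0 (me : R) (V : vec -> R) (c0 : R) : R :=
  sup [set s : R | exists u r, [/\ enorm u < 1, s = enorm u & Ham me V r u <= c0 + 1]].
Definition dbar (me : R) (V : vec -> R) (vbar c0 : R) : R :=
  Num.min ((1 - vbar) / 2) ((1 - s0 me V c0) / 2).

Definition is_sol (M A : vec -> 'M[R]_3) (B : vec -> vec -> vec) (gV : vec -> vec)
    (eps : R) (T : \bar R) (r u y : R -> vec) : Prop :=
  let I := [set t : R | 0 <= t /\ (t%:E < T)%E] in
  let J := [set t : R | 0 < t /\ (t%:E < T)%E] in
  [/\ forall t, I t -> enorm (u t) < 1,
      {within I, continuous r}, {within I, continuous u}, {within I, continuous y} &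
      forall t, J t ->
        [/\ derivable r t 1, derivable u t 1, derivable y t 1,
            'D_1 r t = u t /\ 'D_1 u t = y t &
            y t *m M (u t) = - gV (r t) + eps *: ('D_1 y t *m A (u t))
                             + eps *: B (u t) (y t)]].

Definition eff_sol (rho V : vec -> R) (eps : R) (T : \bar R) (r u y : R -> vec) : Prop :=
  is_sol (mm (m_e rho)) (aa (rho_int rho)) (bb (rho_int rho)) (grad V) eps T r u y.

Definition mod_sol (rho V : vec -> R) (d eps : R) (T : \bar R) (r u y : R -> vec) : Prop :=
  is_sol (fun u => mm (m_e rho) (clip d u)) (fun u => aa (rho_int rho) (clip d u))
         (fun u w => bb (rho_int rho) (clip d u) w) (grad V) eps T r u y.

Definition C1_on_ball (h : vec -> vec -> vec) : Prop :=
  let hh := fun p : vec * vec => h p.1 p.2 in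
  forall p : vec * vec, enorm p.2 < 1 ->
    differentiable hh p /\
    forall v : vec * vec, ('D_v hh x) @[x --> p] --> 'D_v hh p.

End AbrahamDefs.

(* Main.v *)
Require Import Defs.
From HB Require Import structures.
From mathcomp Require Import all_boot all_order all_algebra.
From mathcomp Require Import all_classical all_reals all_analysis.
From mathcomp Require Import ring lra.
Import Order.TTheory GRing.Theory Num.Theory.
Import numFieldNormedType.Exports.
Local Open Scope classical_set_scope.
Local Open Scope ring_scope.

(* Idea.  Along the effective equation the Schott energy
   [G = H - eps u.a(u) udot] is nonincreasing: with kappa = e^2/(12 pi),
   [dG/dt = - eps kappa (gamma^6 |udot|^2 + 6 gamma^8 (u.udot)^2)].
   On the center manifold [udot = h_eps(r,u)] is bounded uniformly in eps, so
   [|G - H| = O(eps)] and [H <= c0 + 1] persists for small eps as long as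
   [|u| <= 1 - dbar]; hence [|u| <= s0 < 1 - dbar], and a first hitting time of
   [|u| = 1 - dbar] is impossible.  Global existence needs no uniqueness: since
   every solution of the modified system starting on the manifold stays on it,
   it suffices to take a Peano solution of the vector field truncated in [u] and
   [udot]; the same barrier shows that the truncations are never active. *)

(** Two obstacles shape the development. At [u = 0] the formulas for [phi], for the self-energy and
    for the axial part of [mf] are quotients with removable singularities, and the norm is not
    differentiable there; quadratic bounds, obtained from explicit estimates of the logarithm,
    replace differentiation at that point. Moreover [is_sol] supplies derivatives only at positive
    times, so the initial energy enters through a one-sided limit. The mass terms leave the balance
    because [m(u) u] is the gradient of [Es]. The truncation lengths are [1 - dbar] for [u] and
    [1 + C] for [udot], where [C] bounds [h_eps]. The energy argument returns the bounds [s0] and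
    [C], both strictly smaller, and this gap is what contradicts continuity at a first exit. *)

(** * Derivative rules for real functions of one variable *)

Section RealCalculus.
Variable R : realType.
Implicit Types (f g df : R -> R) (x s a b : R).

Lemma is_derive_funD f g x a b : is_derive x 1 f a -> is_derive x 1 g b ->
  is_derive x 1 (fun t => f t + g t) (a + b).
Proof. by move=> *; apply: is_deriveD. Qed.

Lemma is_derive_funB f g x a b : is_derive x 1 f a -> is_derive x 1 g b ->
  is_derive x 1 (fun t => f t - g t) (a - b).
Proof. by move=> *; apply: is_deriveB. Qed.

Lemma is_derive_funM f g x a b : is_derive x 1 f a -> is_derive x 1 g b ->
  is_derive x 1 (fun t => f t * g t) (a * g x + f x * b).
Proof.
move=> fa gb; apply: (@is_derive_eq _ _ _ (f * g)).
by rewrite !/GRing.scale /=; ring.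
Qed.

Lemma is_derive_funX f n x a : is_derive x 1 f a ->
  is_derive x 1 (fun t => f t ^+ n) (n%:R * f x ^+ n.-1 * a).
Proof.
move=> fa; have -> : (fun t => f t ^+ n) = f ^+ n.
  by apply/funext => t; rewrite exprfctE.
exact: is_deriveX.
Qed.

Lemma is_derive_funV f x a : f x != 0 -> is_derive x 1 f a ->
  is_derive x 1 (fun t => (f t)^-1) (- (f x) ^- 2 * a).
Proof. by move=> fx fa; apply: is_deriveV. Qed.

Lemma is_derive_val f x a b : is_derive x 1 f a -> a = b -> is_derive x 1 f b.
Proof. by move=> ? <-. Qed.

Lemma is_derive_funcst (c : R) x : is_derive x 1 (fun _ : R => c) 0.
Proof. exact: is_derive_cst. Qed.

Lemma is_derive_funid x : is_derive x 1 (fun t : R => t) 1.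
Proof. exact: is_derive_id. Qed.

Lemma is_derive_funcomp f g x a b : is_derive (g x) 1 f a ->
  is_derive x 1 g b -> is_derive x 1 (fun t => f (g t)) (a * b).
Proof. by move=> fa gb; apply: is_derive1_comp. Qed.

Lemma is_derive_continuous f x a : is_derive x 1 f a -> {for x, continuous f}.
Proof. by case=> fx _; apply/differentiable_continuous/derivable1_diffP. Qed.

Lemma is_derive_near f g x a : (\forall y \near x, f y = g y) ->
  is_derive x 1 g a -> is_derive x 1 f a.
Proof.
move=> fg [gx <-]; split; last by apply: near_eq_derive => //; rewrite oner_eq0.
by apply: near_eq_derivable gx; rewrite ?oner_eq0//; near do apply/esym.
Unshelve. all: by end_near. Qed.

Lemma ler_is_derive_ge0 f df a b : a <= b ->
  (forall x, a <= x <= b -> is_derive x 1 f (df x)) ->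
  (forall x, a <= x <= b -> 0 <= df x) -> f a <= f b.
Proof.
move=> ab dff df0.
have [||c] := @MVT_segment _ f df a b ab.
- by move=> x /itvP xab; apply: dff; rewrite !xab.
- apply: continuous_in_subspaceT => x; rewrite inE /= in_itv /= => xab.
  exact: is_derive_continuous (dff x xab).
move=> cab fE; rewrite -subr_ge0 fE mulr_ge0 ?subr_ge0//.
by apply: df0; move: cab; rewrite in_itv.
Qed.

Lemma is_derive_funN f x a : is_derive x 1 f a ->
  is_derive x 1 (fun t => - f t) (- a).
Proof. by move=> *; apply: is_deriveN. Qed.

End RealCalculus.

(* [notypeclasses refine] keeps the instance search from unfolding the goal. *)
Ltac derive_rules :=
  lazymatch goal with
  | |- is_derive ?x ?v (+%R ?c) ?d =>
    change (is_derive x v (fun t => c + t) d); derive_rules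
  | |- is_derive ?x ?v ( *%R ?c) ?d =>
    change (is_derive x v (fun t => c * t) d); derive_rules
  | |- is_derive _ _ (fun _ => ?c) _ => notypeclasses refine (is_derive_funcst _ c _)
  | |- is_derive _ _ (fun t => t) _ => notypeclasses refine (is_derive_funid _ _)
  | |- is_derive _ _ (fun t => _ - _) _ =>
    notypeclasses refine (is_derive_funB _ _ _ _ _ _ _ _); derive_rules
  | |- is_derive _ _ (fun t => _ + _) _ =>
    notypeclasses refine (is_derive_funD _ _ _ _ _ _ _ _); derive_rules
  | |- is_derive _ _ (fun t => - _) _ =>
    notypeclasses refine (is_derive_funN _ _ _ _ _); derive_rules
  | |- is_derive _ _ (fun t => _ * _) _ =>
    notypeclasses refine (is_derive_funM _ _ _ _ _ _ _ _); derive_rules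
  | |- is_derive _ _ (fun t => _ ^+ _) _ =>
    notypeclasses refine (is_derive_funX _ _ _ _ _ _); derive_rules
  | |- is_derive _ _ (fun t => _ ^-1) _ =>
    notypeclasses refine (is_derive_funV _ _ _ _ _ _); [|derive_rules]
  | |- _ => idtac
  end.

Ltac derive_compute :=
  notypeclasses refine (is_derive_val _ _ _ _ _ _ _); [derive_rules|].

(** * Estimates of log((1 + s)/(1 - s)) *)

(** Twice the inverse hyperbolic tangent, with series 2s + 2s^3/3 + 2s^5/5 + ...; it is the only
    transcendental term of [phi] and [Es]. *)
Definition lnr {R : realType} (s : R) : R := ln ((1 + s) / (1 - s)).

Section LogRatio.
Variable R : realType.
Implicit Types s : R.

Lemma lnr0 : lnr (0 : R) = 0.
Proof. by rewrite /lnr addr0 subr0 divr1 ln1. Qed.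

Lemma is_derive_lnr s : -1 < s < 1 -> is_derive s 1 lnr (2 / (1 - s ^+ 2)).
Proof.
move=> /andP[s0 s1].
have q0 : 0 < (1 + s) / (1 - s) by rewrite divr_gt0//; lra.
apply: is_derive_val.
  apply: is_derive_funcomp; first exact: is_derive1_ln.
  by derive_rules; apply/eqP; lra.
rewrite /=; field.
by do ?[apply/andP; split]; apply/eqP; nra.
Qed.

(** A Taylor polynomial: the difference vanishes at 0 and has derivative 2x^4/(1 - x^2). *)
Lemma le_lnr s : 0 <= s < 1 -> 2 * s + 2 / 3 * s ^+ 3 <= lnr s.
Proof.
move=> /andP[s0 s1]; rewrite -subr_ge0.
pose df x : R := 2 / (1 - x ^+ 2) - (2 + 2 * x ^+ 2).
have := @ler_is_derive_ge0 R (fun x => lnr x - (2 * x + 2 / 3 * x ^+ 3)) df 0 s s0.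
rewrite lnr0 !mulr0 expr0n /= mulr0 addr0 subr0; apply=> x /andP[x0 xs].
  derive_compute; first by apply: is_derive_lnr; apply/andP; split; lra.
  by rewrite /df; field; apply/eqP; nra.
have x1 : 0 < 1 - x ^+ 2 by nra.
rewrite /df subr_ge0 ler_pdivlMr//; nra.
Qed.

(** The true fifth-order coefficient is 2/5. Raising it to 1 absorbs the rest of the series up to
    1/2, since the derivative of the difference has the sign of 3 - 5x^2. *)
Lemma lnr_le_half s : 0 <= s <= 1 / 2 -> lnr s <= 2 * s + 2 / 3 * s ^+ 3 + s ^+ 5.
Proof.
move=> /andP[s0 s1]; rewrite -subr_ge0.
pose df x : R := (2 + 2 * x ^+ 2 + 5 * x ^+ 4) - 2 / (1 - x ^+ 2).
have := @ler_is_derive_ge0 R (fun x => (2 * x + 2 / 3 * x ^+ 3 + x ^+ 5) - lnr x)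
  df 0 s s0.
rewrite lnr0 !mulr0 !expr0n /= mulr0 !addr0 subr0; apply=> x /andP[x0 xs].
  derive_compute; first by apply: is_derive_lnr; apply/andP; split; lra.
  by rewrite /df; field; apply/eqP; nra.
have x1 : 0 < 1 - x ^+ 2 by nra.
have x4 : 0 <= x ^+ 4 by rewrite exprn_ge0.
have x2 : x ^+ 2 <= 1 / 4 by nra.
rewrite /df subr_ge0 ler_pdivrMr//.
have -> : (2 + 2 * x ^+ 2 + 5 * x ^+ 4) * (1 - x ^+ 2)
  = 2 + x ^+ 4 * (3 - 5 * x ^+ 2) by ring.
by rewrite lerDl mulr_ge0//; lra.
Qed.

(** For [s > 0] this is exactly the nonnegativity of the bracket in [Es], because (2 - s^2)/(1 -
    s^2) = 1 + 1/(1 - s^2). *)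
Lemma lnr_le s : 0 <= s < 1 -> lnr s <= s + s / (1 - s ^+ 2).
Proof.
move=> /andP[s0 s1]; rewrite -subr_ge0.
pose df x : R := 1 + (1 + x ^+ 2) / (1 - x ^+ 2) ^+ 2 - 2 / (1 - x ^+ 2).
have := @ler_is_derive_ge0 R (fun x => (x + x / (1 - x ^+ 2)) - lnr x) df 0 s s0.
rewrite lnr0 mul0r addr0 subr0; apply=> x /andP[x0 xs].
  derive_compute; first by apply/eqP; nra.
    by apply: is_derive_lnr; apply/andP; split; lra.
  by rewrite /df /=; field; apply/eqP; nra.
have x1 : 1 - x ^+ 2 != 0 by apply/eqP; nra.
rewrite /df (_ : _ - _ = (x ^+ 2 * (1 + x ^+ 2)) / (1 - x ^+ 2) ^+ 2).
  by rewrite divr_ge0 ?sqr_ge0// mulr_ge0 ?sqr_ge0// addr_ge0// sqr_ge0.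
by field.
Qed.

End LogRatio.

(** * Differentiability through increments *)

Section IncrementCriterion.
Variables (R : realType) (V : normedModType R).

(** Without a quotient and without the excluded point [h = 0], norm estimates on increments yield
    derivatives directly. *)
Lemma is_derive1P (f : R -> V) (x : R) (a : V) : is_derive x 1 f a <->
  forall e : R, 0 < e ->
    \forall h \near (0 : R), `|f (h + x) - f x - h *: a| <= e * `|h|.
Proof.
split=> [[fx <-] e e0|fa].
  have /cvgrPdist_le /(_ _ e0) := fx.
  rewrite near_withinE /=; apply: filterS => h H.
  have [->|h0] := eqVneq h 0.
    by rewrite add0r subrr scale0r subr0 !normr0 mulr0.
  have {}H := H h0; move: H; rewrite (_ : h *: 1%R = h); last first.
    by rewrite /GRing.scale /= mulr1.
  rewrite -(ler_pM2l (_ : 0 < `|h|)) ?normr_gt0// -normrZ scalerBr scalerA.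
  rewrite mulfV// scale1r.
  by move=> H; rewrite -normrN opprB [e * _]mulrC; exact: H.
have cv : h^-1 *: ((f \o shift x) (h *: 1) - f x) @[h --> 0^'] --> a.
  apply/cvgrPdist_le => e e0; rewrite near_withinE /=.
  have := fa e e0; apply: filterS => h H h0.
  rewrite (_ : h *: 1%R = h); last by rewrite /GRing.scale /= mulr1.
  rewrite -[a]scale1r -(mulVf h0) -scalerA -scalerBr normrZ distrC normfV mulrC.
  by rewrite ler_pdivrMr ?normr_gt0.
by split; [apply/cvg_ex; exists a|apply/cvg_lim].
Qed.

End IncrementCriterion.

(** * The self-energy and [phi] as functions of the speed *)

(** The field energy in [Es] in units of [3 * me]; the value at 0 is the limit of the formula. *)
Definition coulomb {R : realType} (s : R) : R :=
  if s == 0 then 0 else (2 - s ^+ 2) / (2 * (1 - s ^+ 2)) - (2 * s)^-1 * lnr s.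

Section SelfEnergy.
Variable R : realType.
Implicit Types (s t p me : R) (q f g : R -> R).

(** A squeeze: increments of [f] inherit the o(h) of those of [g]. It serves where the square root
    is not differentiable. *)
Lemma is_derive_dominated f g (K t : R) : is_derive t 1 g 0 -> g t = 0 ->
  f t = 0 -> (\forall x \near t, `|f x| <= K * `|g x|) -> is_derive t 1 f 0.
Proof.
move=> dg gt ft fg; apply/is_derive1P => e e0.
have K0 : 0 < `|K| + 1 by rewrite ltr_wpDl.
have /is_derive1P /(_ (e / (`|K| + 1))) := dg.
rewrite divr_gt0// => /(_ isT) Hg.
have Hf : \forall h \near (0 : R), `|f (h + t)| <= K * `|g (h + t)|.
  have : (fun h : R => h + t) @ (0 : R) --> 0 + t.
    by apply: cvgD; [exact: cvg_id|exact: cvg_cst].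
  by rewrite add0r => /(_ _ fg).
apply: filterS2 Hg Hf => h; rewrite gt ft scaler0 !subr0 => gh fh.
apply: (le_trans fh).
apply: (@le_trans _ _ ((`|K| + 1) * `|g (h + t)|)).
  by rewrite ler_wpM2r// (le_trans (ler_norm _))// lerDl.
by rewrite -ler_pdivlMl// mulrA [_^-1 * e]mulrC.
Qed.

Lemma EsE me (u : vec R) : Es me u = gamma u - 1 + 3 * me * coulomb (enorm u).
Proof. by []. Qed.

Lemma coulomb_ge0 s : 0 <= s < 1 -> 0 <= coulomb s.
Proof.
move=> /andP[s0 s1]; rewrite /coulomb; case: eqVneq => // sN0.
have sp : 0 < s by rewrite lt_def sN0.
have := @lnr_le R s; rewrite s0 s1 => /(_ isT) H.
have q1 : 0 < 1 - s ^+ 2 by nra.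
rewrite subr_ge0 mulrC ler_pdivrMr; last by lra.
apply: (le_trans H); rewrite le_eqVlt; apply/orP; left; apply/eqP; field.
by apply/eqP; lra.
Qed.

Lemma coulomb_le s : 0 <= s < 1 -> coulomb s <= s ^+ 2 / (2 * (1 - s ^+ 2)).
Proof.
move=> /andP[s0 s1]; rewrite /coulomb; case: eqVneq => [->|sN0].
  by rewrite expr0n mul0r.
have sp : 0 < s by rewrite lt_def sN0.
have := @le_lnr R s; rewrite s0 s1 => /(_ isT) H.
have q1 : 0 < 1 - s ^+ 2 by nra.
have L1 : 1 <= (2 * s)^-1 * lnr s.
  rewrite mulrC ler_pdivlMr; last by lra.
  by apply: le_trans H; rewrite mul1r lerDl mulr_ge0// exprn_ge0.
have -> : (2 - s ^+ 2) / (2 * (1 - s ^+ 2)) = s ^+ 2 / (2 * (1 - s ^+ 2)) + 1.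
  by field; apply/eqP; lra.
by lra.
Qed.

Lemma phiE s : s != 0 ->
  phi s = (2 * s ^+ 2 * (1 - s ^+ 2))^-1 - (4 * s ^+ 3)^-1 * lnr s.
Proof. by rewrite /phi => /negbTE ->. Qed.

Lemma near_neq0 s : s != 0 -> \forall x \near s, x != 0.
Proof.
move=> s0; apply: (@open_nbhs_nbhs _ s [set x : R | x != 0]).
by split => //; exact: open_neq.
Qed.

(** Up to [3 * me], the derivative is [s] times the longitudinal eigenvalue phi + s phi' of [mf].
    This relation between energy and mass removes the field mass from the energy balance. *)
Lemma is_derive_coulomb s : 0 < s < 1 ->
  is_derive s 1 coulomb (s * ((1 - s ^+ 2) ^- 2 - 2 * phi s)).
Proof.
move=> /andP[s0 s1]; have sN0 : s != 0 by rewrite gt_eqF.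
have q1 : 1 - s ^+ 2 != 0 by apply/eqP; nra.
apply: (@is_derive_near _ _
    (fun s => (2 - s ^+ 2) / (2 * (1 - s ^+ 2)) - (2 * s)^-1 * lnr s)).
  have := near_neq0 _ sN0; apply: filterS => x x0.
  by rewrite /coulomb (negbTE x0).
derive_compute.
- by rewrite mulf_neq0// pnatr_eq0.
- by rewrite mulf_neq0// pnatr_eq0.
- by apply: is_derive_lnr; rewrite s1 andbT; lra.
rewrite phiE//=; field; apply/andP; split=> //; apply/eqP; nra.
Qed.

(** Equivalently, s^3 phi has derivative s^2 (1 - s^2)^-2. This first-order equation lets phi' be
    eliminated algebraically later on. *)
Lemma is_derive_phi s : 0 < s < 1 ->
  is_derive s 1 (@phi R) (((1 - s ^+ 2) ^- 2 - 3 * phi s) / s).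
Proof.
move=> /andP[s0 s1]; have sN0 : s != 0 by rewrite gt_eqF.
have q1 : 1 - s ^+ 2 != 0 by apply/eqP; nra.
apply: (@is_derive_near _ _
    (fun s => (2 * s ^+ 2 * (1 - s ^+ 2))^-1 - (4 * s ^+ 3)^-1 * lnr s)).
  have := near_neq0 _ sN0; apply: filterS => x x0.
  by rewrite phiE.
derive_compute.
- by rewrite !mulf_neq0// ?pnatr_eq0// expf_neq0.
- by rewrite !mulf_neq0// ?pnatr_eq0// expf_neq0.
- by apply: is_derive_lnr; rewrite s1 andbT; lra.
rewrite phiE//=; field; apply/andP; split=> //; apply/eqP; nra.
Qed.

(** With the lower and upper bounds on [lnr] the poles 1/(2s^2) cancel and 1/2 - 1/6 = 1/3 remains,
    with an error of order s^2. *)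
Lemma phi_near0 s : 0 <= s <= 1 / 2 -> `|phi s - 1 / 3| <= s ^+ 2.
Proof.
move=> /andP[s0 s1]; have [->|sN0] := eqVneq s 0.
  by rewrite /phi eqxx subrr normr0 sqr_ge0.
have sp : 0 < s by rewrite lt_def sN0.
have := @le_lnr R s; rewrite s0 /= => /(_ _) H1; have {}H1 := H1 ltac:(lra).
have := @lnr_le_half R s; rewrite s0 s1 => /(_ isT) H2.
rewrite phiE//; set q := s ^+ 2.
have qp : 0 < q by rewrite exprn_gt0.
have q4 : q <= 1 / 4 by rewrite /q; nra.
have s3 : 0 < 4 * s ^+ 3 by rewrite mulr_gt0// exprn_gt0.
have M1 : 1 / (2 * q) + 1 / 6 <= (4 * s ^+ 3)^-1 * lnr s.
  rewrite [_^-1 * _]mulrC ler_pdivlMr//; apply: le_trans H1.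
  rewrite le_eqVlt; apply/orP; left; apply/eqP; rewrite /q; field.
  by apply/eqP; lra.
have M2 : (4 * s ^+ 3)^-1 * lnr s <= 1 / (2 * q) + 1 / 6 + q / 4.
  rewrite mulrC ler_pdivrMr//; apply: (le_trans H2).
  rewrite le_eqVlt; apply/orP; left; apply/eqP; rewrite /q; field.
  by apply/eqP; lra.
have A : (2 * q * (1 - q))^-1 = 1 / (2 * q) + 1 / 2 + q / 2 * (1 - q)^-1.
  by field; apply/andP; split; apply/eqP; lra.
have a1 : 1 <= (1 - q)^-1 by rewrite -[_^-1]mul1r ler_pdivlMr; lra.
have a2 : (1 - q)^-1 <= 4 / 3 by rewrite -[_^-1]mul1r ler_pdivrMr; lra.
rewrite A ler_norml; apply/andP; split; nra.
Qed.

(** Here [q] stands for |u|^2 along a curve. At a zero of [q] the chain rule through the root fails,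
    but [coulomb] of the root is at most [q] once [q <= 1/2], and [q] has derivative 0 there. *)
Lemma is_derive_coulomb_sqrt q t p : (forall x, 0 <= q x) -> q t < 1 ->
  is_derive t 1 q (2 * p) -> (q t = 0 -> p = 0) ->
  is_derive t 1 (fun x => coulomb (Num.sqrt (q x)))
    (p * ((1 - q t) ^- 2 - 2 * phi (Num.sqrt (q t)))).
Proof.
move=> q0 q1 dq qp; have [qt0|qtN0] := eqVneq (q t) 0.
  rewrite qp// mul0r; apply: (@is_derive_dominated _ q 1) => //.
  - by move: dq; rewrite qp// mulr0.
  - by rewrite qt0 sqrtr0 /coulomb eqxx.
  have : q x @[x --> t] --> 0.
    by rewrite -[X in _ --> X]qt0; exact: is_derive_continuous dq.
  move=> /cvgrPdist_lt /(_ (1 / 2)) /(_ ltac:(lra)).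
  apply: filterS => x; rewrite sub0r normrN ger0_norm// => qx.
  have sq : Num.sqrt (q x) ^+ 2 = q x by rewrite sqr_sqrtr.
  have s1 : 0 <= Num.sqrt (q x) < 1.
    rewrite sqrtr_ge0 -(@ltr_sqr _ (Num.sqrt _)) ?nnegrE ?sqrtr_ge0// sq expr1n; lra.
  rewrite ger0_norm ?coulomb_ge0// mul1r (le_trans (coulomb_le _ s1))// sq.
  by rewrite ler_pdivrMr; have := q0 x; [nra|lra].
have qt : 0 < q t by rewrite lt_def qtN0 q0.
have sq : Num.sqrt (q t) ^+ 2 = q t by rewrite sqr_sqrtr.
have sp : 0 < Num.sqrt (q t) by rewrite sqrtr_gt0.
apply: is_derive_val.
  apply: is_derive_funcomp.
    apply: is_derive_coulomb; rewrite sp /=.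
    by rewrite -(@ltr_sqr _ (Num.sqrt _)) ?nnegrE ?sqrtr_ge0// sq expr1n.
  apply: is_derive_funcomp dq.
  exact: is_derive1_sqrt.
by rewrite sq; field; apply/andP; split; apply/eqP; lra.
Qed.

End SelfEnergy.

(** * Peano existence for a bounded continuous field, by Euler's method *)

Section Peano.
Variables (R : realType) (E : normedModType R).
Hypothesis compact_balls : forall (x : E) (r : R), compact [set y | `|y - x| <= r].
Variables (f : E -> E) (M : R) (x0 : E).
Hypothesis f_continuous : continuous f.
Hypothesis f_bounded : forall x, `|f x| <= M.

(** Compactness supplies a cluster point. An ultrafilter contains each set or its complement, so a
    cluster point is already a limit. *)
Lemma ultra_fmap_cvg (T : Type) (U : set_system T) (u : T -> E) (x : E) (r : R) :
  UltraFilter U -> U [set n | `|u n - x| <= r] -> exists l : E, u @ U --> l.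
Proof.
move=> UU uK; have [l [_ cl]] := compact_balls x r (u @ U) _ uK.
exists l => A lA; have [//|UA] := in_ultra_setVsetC (u @^-1` A) UU.
have : (u @ U) (~` A) by [].
by move=> /cl /(_ lA) [z []].
Qed.

Definition euler (d : R) (k : nat) : E := iter k (fun x => x + d *: f x) x0.

(** The steps telescope, each deviating from [d *: c] by at most [d * e]. The case [c = 0] gives the
    Lipschitz bound; taking [c] to be the field at the limit point gives the derivative. *)
Lemma euler_increment d e c j m : 0 <= d ->
  (forall i, (i < m)%N -> `|f (euler d (j + i)) - c| <= e) ->
  `|euler d (j + m) - euler d j - (m%:R * d) *: c| <= m%:R * d * e.
Proof.
move=> d0; elim: m => [|m IH] H.
  by rewrite addn0 subrr !mul0r scale0r subr0 normr0.
have {}IH := IH (fun i im => H i (ltnW im)).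
have -> : euler d (j + m.+1) = euler d (j + m) + d *: f (euler d (j + m)).
  by rewrite addnS.
have -> : m.+1%:R = m%:R + 1 :> R by rewrite -natr1.
have -> : euler d (j + m) + d *: f (euler d (j + m)) - euler d j -
    ((m%:R + 1) * d) *: c = (euler d (j + m) - euler d j - (m%:R * d) *: c)
    + d *: (f (euler d (j + m)) - c).
  rewrite mulrDl mul1r scalerDl opprD scalerBr.
  by rewrite [X in X + _ = _]addrAC addrACA.
rewrite mulrDl mul1r mulrDl (le_trans (ler_normD _ _))// lerD//.
by rewrite normrZ ger0_norm// ler_wpM2l// H.
Qed.

Lemma euler_lipschitz d j m : 0 <= d ->
  `|euler d (j + m) - euler d j| <= m%:R * d * M.
Proof.
move=> d0; have := euler_increment d M 0 j m d0.
by rewrite scaler0 subr0; apply=> i _; rewrite subr0.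
Qed.

(** Piecewise constant in time with mesh 1/(n + 1). Since [Num.truncn] sends negative reals to 0,
    the value is [x0] for all [t <= 0]. *)
Definition euler_step (n : nat) (t : R) : E :=
  euler n.+1%:R^-1 (Num.truncn (t * n.+1%:R)).

(** Rounding both times down miscounts the steps by at most one. The two-sided estimate needs
    [0 <= s], because all negative times are rounded to step 0. *)
Lemma truncn_increment (n : nat) (s t : R) : s <= t ->
  exists m : nat, [/\ Num.truncn (t * n.+1%:R) = (Num.truncn (s * n.+1%:R) + m)%N,
    m%:R * n.+1%:R^-1 <= t - s + n.+1%:R^-1 &
    0 <= s -> `|m%:R * n.+1%:R^-1 - (t - s)| <= n.+1%:R^-1].
Proof.
move=> st; set N : R := n.+1%:R.
have N0 : 0 < N by rewrite ltr0n.
have stN : s * N <= t * N by rewrite ler_wpM2r// ltW.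
have le_st := le_truncn stN.
exists (Num.truncn (t * N) - Num.truncn (s * N))%N.
have trunc_lt0 (x : R) : x < 0 -> Num.truncn x = 0%N.
  by move=> xlt0; apply/truncn0Pn; rewrite -ltNge (lt_trans xlt0).
rewrite subnKC// natrB//.
have scale x : x <= (t - s) * N + 1 -> x * N^-1 <= t - s + N^-1.
  by move=> H; rewrite ler_pdivrMr// mulrDl mulVf ?gt_eqF.
have key : (Num.truncn (t * N))%:R - (Num.truncn (s * N))%:R <= (t - s) * N + 1.
  have [s0|s0] := leP 0 (s * N).
    have /andP[_] := truncn_itv s0; rewrite -natr1 => sN.
    have /andP[tN _] := truncn_itv (le_trans s0 stN).
    by lra.
  rewrite (trunc_lt0 _ s0) subr0; have [t0|t0] := leP 0 (t * N).
    by have /andP[tN _] := truncn_itv t0; nra.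
  by rewrite trunc_lt0// addr_ge0// mulr_ge0// ?subr_ge0// ltW.
split=> //; first exact: scale.
move=> s0; rewrite ler_distl; apply/andP; split; last exact: scale.
have s0' : 0 <= s * N by rewrite mulr_ge0// ltW.
have /andP[sN _] := truncn_itv s0'.
have /andP[_] := truncn_itv (le_trans s0' stN); rewrite -natr1 => tN.
rewrite ler_pdivlMr// mulrBl mulVf ?gt_eqF//.
by lra.
Qed.

Lemma euler_step_lipschitz n s t : s <= t ->
  `|euler_step n t - euler_step n s| <= M * (t - s + n.+1%:R^-1).
Proof.
move=> st; have [m [mE mle _]] := truncn_increment n _ _ st.
rewrite /euler_step mE (le_trans (euler_lipschitz _ _ _ _))// mulrC ler_wpM2l//.
exact: le_trans (f_bounded x0).
Qed.

(** The field has to be close to [c] only on a ball that the Euler points cannot leave in the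
    elapsed time. The last error term, due to the miscounted step, vanishes as [n] grows. *)
Lemma euler_step_increment n s t c e : 0 <= s <= t -> 0 <= e ->
  (forall x, `|x - euler_step n s| <= M * (t - s + n.+1%:R^-1) ->
    `|f x - c| <= e) ->
  `|euler_step n t - euler_step n s - (t - s) *: c| <=
    (t - s) * e + n.+1%:R^-1 * (e + `|c|).
Proof.
move=> /andP[s0 st] e0 H.
have [m [mE mle /(_ s0) mdist]] := truncn_increment n _ _ st.
have M0 : 0 <= M by exact: le_trans (f_bounded x0).
have d0 : 0 <= n.+1%:R^-1 :> R by rewrite invr_ge0.
have {}H i : (i < m)%N ->
    `|f (euler n.+1%:R^-1 (Num.truncn (s * n.+1%:R) + i)) - c| <= e.
  move=> im; apply: H; rewrite (le_trans (euler_lipschitz _ _ _ _))// mulrC.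
  by rewrite ler_wpM2l// (le_trans _ mle)// ler_wpM2r// ler_nat ltnW.
have := euler_increment _ _ _ _ _ d0 H; rewrite -mE -!/(euler_step n _).
set X := euler_step n t - euler_step n s => Xle.
have -> : X - (t - s) *: c = (X - (m%:R * n.+1%:R^-1) *: c)
    + (m%:R * n.+1%:R^-1 - (t - s)) *: c.
  by rewrite (scalerBl _ (t - s)) addrA subrK.
rewrite (le_trans (ler_normD _ _))// normrZ mulrDr addrA lerD//; last first.
  by rewrite ler_wpM2r.
by rewrite (le_trans Xle)// -mulrDl ler_wpM2r.
Qed.

(* [X t] is the limit of the Euler step functions at [t] along an ultrafilter:
   the increment estimate passes to this pointwise limit, so that no
   equicontinuity or Arzela-Ascoli argument is needed. *)
Theorem peano_existence : exists X : R -> E, [/\ X 0 = x0, continuous X &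
  forall t : R, 0 < t -> is_derive t 1 X (f (X t))].
Proof.
have M0 : 0 <= M by exact: le_trans (f_bounded x0).
have [U [UU ooU]] := ultraFilterLemma (F := \oo) _.
pose d (n : nat) : R := n.+1%:R^-1.
have dU : d @ U --> 0 by apply: cvg_trans cvg_harmonic; exact: cvg_fmap2.
have cvgX t : exists l : E, euler_step ^~ t @ U --> l.
  (* Comparison with time [- |t|], where the Euler curve is still at [x0], gives a radius
     independent of [n]. *)
  apply: (ultra_fmap_cvg _ U _ x0 (M * (2 * `|t| + 1))); apply: filterE => n /=.
  have nt : - `|t| <= t by rewrite lerNl ler_normr lexx orbT.
  have := euler_step_lipschitz n _ _ nt.
  rewrite {2}/euler_step (_ : Num.truncn _ = 0%N) => [H|]; last first.
    by apply/truncn0Pn; rewrite -ltNge (@le_lt_trans _ _ 0)// mulr_le0_ge0 ?oppr_le0.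
  rewrite (le_trans H)// ler_wpM2l// opprK lerD ?invr_le1 ?unitfE ?ler1n//.
  by rewrite mulr_natl mulr2n lerD2r ler_norm.
pose X t := sval (cid (cvgX t)).
have XP t : euler_step ^~ t @ U --> X t := svalP (cid (cvgX t)).
have X_lip s t : s <= t -> `|X t - X s| <= M * (t - s).
  move=> st; apply: (@ler_cvg_to _ U _ _ (fun n => `|euler_step n t - euler_step n s|)
    (fun n => M * (t - s + d n))).
  - by apply: cvg_norm; apply: cvgB; exact: XP.
  - rewrite -[X in _ --> M * X]addr0; apply: cvgMr.
    by apply: cvgD; [exact: cvg_cst|exact: dU].
  - by near=> n; exact: euler_step_lipschitz.
have X_lip' s t : `|X t - X s| <= M * `|t - s|.
  have [st|/ltW ts] := leP s t.
    by rewrite ger0_norm ?subr_ge0//; exact: X_lip.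
  by rewrite distrC [`|t - s|]distrC ger0_norm ?subr_ge0//; exact: X_lip.
exists X; split.
- have euler0 : euler_step ^~ 0 @ U --> x0.
    have -> : euler_step ^~ 0 = cst x0.
      by apply/funext => n; rewrite /euler_step mul0r truncn0.
    exact: cvg_cst.
  exact: (norm_cvg_unique (XP 0) euler0).
- have M1 : 0 < M + 1 by rewrite ltr_wpDl.
  move=> t; apply/cvgrPdist_le => e e0.
  apply/nbhs_ballP; exists (e / (M + 1)); first by rewrite /= divr_gt0.
  move=> s; rewrite /ball /= ltr_pdivlMr// => /ltW ts.
  by rewrite (le_trans (X_lip' _ _))// (le_trans _ ts)// mulrC ler_wpM2l// lerDl.
move=> t t0; set c := f (X t).
apply/is_derive1P => e e0.
have /cvgrPdist_le /(_ e e0) := f_continuous (X t).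
move=> /nbhs_ballP [r /= r0 fr].
(* The radius [r] is shared out: r/4 for the distance to the pointwise limit, r/2 for motion over a
   total time of at most [3 * h0], and r/4 for two mesh errors. The bound [h0 <= t] keeps all times
   nonnegative. *)
have h0P : exists h0, [/\ 0 < h0, h0 <= t & M * (3 * h0) < r / 2].
  exists (Num.min t (r / (12 * (M + 1)))); split.
  - by rewrite lt_min t0 divr_gt0// mulr_gt0// ltr_wpDl.
  - by rewrite ge_min lexx.
  - set k := r / (12 * (M + 1)); have k0 : 0 < k by rewrite divr_gt0// mulr_gt0// ltr_wpDl.
    have kE : k * (12 * (M + 1)) = r by rewrite /k mulfVK// gt_eqF// mulr_gt0// ltr_wpDl.
    have km : Num.min t k <= k by rewrite ge_min lexx orbT.
    by nra.
have [h0 [h0_gt0 h0t Mh0]] := h0P.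
have increment a b : a <= b -> t - h0 <= a -> b <= t + h0 -> a <= t -> t <= b ->
    `|X b - X a - (b - a) *: c| <= (b - a) * e.
  move=> ab ta bt at_ tb; apply: (@ler_cvg_to _ U _ _
    (fun n => `|euler_step n b - euler_step n a - (b - a) *: c|)
    (fun n => (b - a) * e + d n * (e + `|c|))).
  - by apply: cvg_norm; apply: cvgB; [apply: cvgB; exact: XP|exact: cvg_cst].
  - rewrite -[X in _ --> X]addr0 -[X in _ --> _ + X](mul0r (e + `|c|)).
    by apply: cvgD; [exact: cvg_cst|apply: cvgMl].
  - have dM : 0 < 2 * M + 1 by lra.
    have r4 : 0 < r / 4 by rewrite divr_gt0.
    move/cvgrPdist_lt/(_ _ r4): (XP t) => HX.
    move/cvgrPdist_lt/(_ _ (divr_gt0 r4 dM)): (dU) => Hd.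
    apply: filterS2 HX Hd => n Xn; rewrite sub0r normrN ltr_pdivlMr//.
    rewrite ger0_norm ?invr_ge0// => dnM; apply: euler_step_increment.
    + by rewrite ab andbT; lra.
    + exact: ltW.
    + move=> x xa; rewrite distrC; apply: fr; rewrite -ball_normE /=.
      have d0 : 0 <= d n by rewrite invr_ge0.
      have := euler_step_lipschitz n _ _ at_; rewrite -/(d n) => Xa.
      move: xa; rewrite -/(d n) => xa.
      have -> : X t - x = (X t - euler_step n t) + (euler_step n t - euler_step n a)
          - (x - euler_step n a).
        by rewrite subrKA opprB subrKA.
      rewrite (le_lt_trans (ler_normB _ _))//.
      rewrite (le_lt_trans (lerD (ler_normD _ _) (lexx _)))//.
      by nra.
have : \forall h \near (0 : R), `|h| <= h0 by exact: nbhs0_le.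
apply: filterS => h; rewrite ler_norml => /andP[hh0 hh0'].
have [h_ge0|/ltW h_le0] := leP 0 h.
  have := increment t (h + t); rewrite ger0_norm// addrK mulrC; apply; lra.
have := increment (h + t) t; rewrite (_ : t - (h + t) = - h); last by ring.
rewrite ler0_norm// -normrN scaleNr opprK opprD opprB [e * _]mulrC.
by apply; lra.
Unshelve. all: by end_near. Qed.

End Peano.

(** * Euclidean structure of R^3 *)

Section DotProduct.
Variable R : realType.
Implicit Types (u v w : vec R) (c : R).

Lemma ord3P (i : 'I_3) : [\/ i = 0, i = 1 | i = 2%:R].
Proof.
by case: i => -[|[|[|//]]] i; [apply: Or31|apply: Or32|apply: Or33]; apply/val_inj.
Qed.

Lemma dotE u w : dot u w = u 0 0 * w 0 0 + u 0 1 * w 0 1 + u 0 2%:R * w 0 2%:R.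
Proof.
rewrite /dot !big_ord_recl big_ord0 addr0 addrA.
by congr (_ * _ + _ * _ + _ * _); congr (_ 0 _); apply/val_inj.
Qed.

Lemma dotC u w : dot u w = dot w u.
Proof. by rewrite !dotE; ring. Qed.

Lemma dotDl u v w : dot (u + v) w = dot u w + dot v w.
Proof. by rewrite !dotE !mxE; ring. Qed.

Lemma dotNl u w : dot (- u) w = - dot u w.
Proof. by rewrite !dotE !mxE; ring. Qed.

Lemma dotZl c u w : dot (c *: u) w = c * dot u w.
Proof. by rewrite !dotE !mxE; ring. Qed.

Lemma dot_ge0 u : 0 <= dot u u.
Proof. by rewrite dotE -!expr2 !addr_ge0 ?sqr_ge0. Qed.

Lemma dot_eq0 u : dot u u = 0 -> u = 0.
Proof.
rewrite dotE -!expr2 => /eqP.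
rewrite !paddr_eq0 ?addr_ge0 ?sqr_ge0// !sqrf_eq0 => /andP[/andP[/eqP h0 /eqP h1] /eqP h2].
by apply/rowP => i; rewrite mxE; have [->|->|->] := ord3P i.
Qed.

Lemma enorm_ge0 u : 0 <= enorm u.
Proof. exact: sqrtr_ge0. Qed.

Lemma enorm_sq u : enorm u ^+ 2 = dot u u.
Proof. by rewrite /enorm sqr_sqrtr// dot_ge0. Qed.

Lemma enormZ c u : enorm (c *: u) = `|c| * enorm u.
Proof. by rewrite /enorm dotZl dotC dotZl mulrA -expr2 sqrtrM ?sqr_ge0// sqrtr_sqr. Qed.

Lemma enorm_eq0 u : enorm u = 0 -> u = 0.
Proof. by move=> u0; apply: dot_eq0; rewrite -enorm_sq u0 expr0n. Qed.

(** Lagrange's identity: the defect is the sum of the squared components of the cross product. *)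
Lemma cauchy_schwarz u w : `|dot u w| <= enorm u * enorm w.
Proof.
rewrite -(@ler_sqr _ `|_|) ?nnegrE ?mulr_ge0 ?enorm_ge0//.
rewrite real_normK ?num_real// exprMn !enorm_sq -subr_ge0 !dotE.
rewrite (_ : _ - _ = (u 0 0 * w 0 1 - u 0 1 * w 0 0) ^+ 2 +
  (u 0 0 * w 0 2%:R - u 0 2%:R * w 0 0) ^+ 2 +
  (u 0 1 * w 0 2%:R - u 0 2%:R * w 0 1) ^+ 2); last by ring.
by rewrite !addr_ge0 ?sqr_ge0.
Qed.

Lemma mulmx_outer w u : w *m outer u = dot w u *: u.
Proof.
rewrite /outer mulmxA; have -> : w *m u^T = (dot w u)%:M.
  by apply/matrixP => i j; rewrite !mxE !ord1 eqxx mulr1n; apply: eq_bigr => k _; rewrite mxE.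
by rewrite mul_scalar_mx.
Qed.

Lemma is_derive_dot (u w : R -> vec R) (t : R) (u' w' : vec R) :
  (forall i, is_derive t 1 (fun s => u s 0 i) (u' 0 i)) ->
  (forall i, is_derive t 1 (fun s => w s 0 i) (w' 0 i)) ->
  is_derive t 1 (fun s => dot (u s) (w s)) (dot u' (w t) + dot (u t) w').
Proof.
move=> du dw.
have -> : (fun s => dot (u s) (w s)) = (fun s => u s 0 0 * w s 0 0 +
    u s 0 1 * w s 0 1 + u s 0 2%:R * w s 0 2%:R) by apply/funext => s; rewrite dotE.
derive_compute; [exact: du|exact: dw|exact: du|exact: dw|exact: du|exact: dw|].
by rewrite !dotE; ring.
Qed.

Lemma is_derive_coord (f : R -> vec R) (t : R) (v : vec R) (i : 'I_3) :
  is_derive t 1 f v -> is_derive t 1 (fun s => f s 0 i) (v 0 i).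
Proof.
move=> [df <-]; have dfi := (derivable_mxP f t 1).1 df 0 i.
by split => //; rewrite derive_mx// mxE.
Qed.

End DotProduct.

(** * Chain rule for the potential from continuous partial derivatives *)

Section ChainRule.
Variables (R : realType) (V : vec R -> R).
Hypothesis dV : forall i x, derivable V x (ev R i).
Hypothesis cV : forall i, continuous (pd i V).

Lemma is_derive_line (z : vec R) (i : 'I_3) (x : R) :
  is_derive x 1 (fun s => V (z + s *: ev R i)) (pd i V (z + x *: ev R i)).
Proof.
have E : (fun h : R => h^-1 *: (((fun s => V (z + s *: ev R i)) \o shift x) (h *: 1)
      - V (z + x *: ev R i)))
  = (fun h : R => h^-1 *: ((V \o shift (z + x *: ev R i)) (h *: ev R i)
      - V (z + x *: ev R i))).
  apply/funext => h /=; congr (_ *: (V _ - _)).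
  by rewrite [h *: 1]/GRing.scale /= mulr1 scalerDl addrCA addrA addrC addrA.
have := dV i (z + x *: ev R i); rewrite /derivable -E => d.
by split => //; rewrite /derive E.
Qed.

Lemma mean_value_line (z : vec R) (i : 'I_3) (w : R) :
  exists2 s : R, `|s| <= `|w| &
    V (z + w *: ev R i) - V z = w * pd i V (z + s *: ev R i).
Proof.
have cont a b : {within `[a, b], continuous (fun s => V (z + s *: ev R i))}.
  apply: continuous_subspaceT => x.
  by apply/differentiable_continuous/derivable1_diffP; case: (is_derive_line z i x).
have V0 : V (z + 0 *: ev R i) = V z by rewrite scale0r addr0.
have [w0|/ltW w0] := leP 0 w.
  have [||s] := @MVT_segment _ (fun s => V (z + s *: ev R i))
    (fun x => pd i V (z + x *: ev R i)) 0 w w0.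
  - by move=> x _; exact: is_derive_line.
  - exact: cont.
  rewrite in_itv /= V0 subr0 => /andP[s0 sw] ->; exists s; last by rewrite mulrC.
  by rewrite !ger0_norm.
have [||s] := @MVT_segment _ (fun s => V (z + s *: ev R i))
  (fun x => pd i V (z + x *: ev R i)) w 0 w0.
- by move=> x _; exact: is_derive_line.
- exact: cont.
rewrite in_itv /= V0 sub0r => /andP[s0 sw] E; exists s.
  by rewrite !ler0_norm// lerN2.
by rewrite -[LHS]opprB E mulrN opprK mulrC.
Qed.

Lemma mx_norm_coord (x : vec R) (i : 'I_3) : `|x 0 i| <= `|x|.
Proof.
rewrite [leRHS]/Num.Def.normr /= mx_normrE.
exact: (le_bigmax _ (fun j => `|x j.1 j.2|) (0, i)).
Qed.

Lemma norm_ev_le1 (i : 'I_3) : `|ev R i| <= 1.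
Proof.
rewrite [leLHS]/Num.Def.normr /= mx_normrE; apply: bigmax_le => // j _.
by rewrite mxE; case: (_ && _); rewrite ?normr1 ?normr0.
Qed.

(** The base point moves with [x], yet its mere continuity suffices: by the mean value theorem the
    difference is [w x] times a partial derivative taken at a point that tends to [z t]. *)
Lemma is_derive_partial (z : R -> vec R) (w : R -> R) (i : 'I_3) (t v : R) :
  {for t, continuous z} -> w t = 0 -> is_derive t 1 w v ->
  is_derive t 1 (fun x => V (z x + w x *: ev R i) - V (z x)) (pd i V (z t) * v).
Proof.
move=> cz wt dw; set c := pd i V (z t).
have rho : is_derive t 1
    (fun x => (V (z x + w x *: ev R i) - V (z x)) - c * w x) 0.
  apply/is_derive1P => e e0; rewrite wt scale0r addr0 !subrr mulr0 subrr.
  have v1 : 0 < `|v| + 1 by rewrite ltr_wpDl.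
  have /cvgrPdist_le /(_ _ (divr_gt0 e0 v1)) := cV i (z t).
  move=> /nbhs_ballP [d /= d0 dP].
  have d2 : 0 < d / 2 by rewrite divr_gt0.
  have sh : (fun h : R => h + t) @ (0 : R) --> t.
    by rewrite -[X in _ --> X]add0r; apply: cvgD; [exact: cvg_id|exact: cvg_cst].
  have /cvgrPdist_lt /(_ _ d2) Hz := cz.
  have cw : w x @[x --> t] --> 0.
    by rewrite -[X in _ --> X]wt; exact: is_derive_continuous dw.
  have /cvgrPdist_lt /(_ _ d2) Hw := cw.
  have /is_derive1P /(_ 1 ltr01) Hd := dw.
  have Hz' : \forall h \near (0 : R), `|z t - z (h + t)| < d / 2 := sh _ Hz.
  have Hw' : \forall h \near (0 : R), `|0 - w (h + t)| < d / 2 := sh _ Hw.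
  apply: filterS3 Hz' Hw' Hd => h zh; rewrite sub0r normrN => wh.
  rewrite wt subr0 mul1r scaler0 !subr0 => dh.
  have [s sw ->] := mean_value_line (z (h + t)) i (w (h + t)).
  rewrite [c * _]mulrC -mulrBr normrM.
  have wle : `|w (h + t)| <= (`|v| + 1) * `|h|.
    rewrite -[w _](subrK (h *: v)) (le_trans (ler_normD _ _))// mulrDl mul1r addrC.
    by rewrite lerD// normrM mulrC.
  have pc : `|pd i V (z (h + t) + s *: ev R i) - c| <= e / (`|v| + 1).
    rewrite distrC; apply: dP; rewrite -ball_normE /= opprD addrA.
    rewrite (le_lt_trans (ler_normB _ _))// (splitr d) ltr_leD// normrZ.
    by rewrite (le_trans _ (ltW wh))// (le_trans _ sw)// ler_piMr// norm_ev_le1.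
  apply: (le_trans (ler_pM _ _ wle pc)) => //.
  rewrite le_eqVlt; apply/orP; left; apply/eqP; field.
  by rewrite gt_eqF.
have dcw := is_derive_funM _ _ _ _ _ _ (is_derive_funcst _ c t) dw.
have := is_derive_funD _ _ _ _ _ _ rho dcw; rewrite mul0r !add0r.
by congr is_derive; apply/funext => x; rewrite subrK.
Qed.

Lemma is_derive_potential (r : R -> vec R) (t : R) (v : vec R) :
  (forall i, is_derive t 1 (fun s => r s 0 i) (v 0 i)) ->
  is_derive t 1 (fun s => V (r s)) (dot (grad V (r t)) v).
Proof.
move=> dr; pose w i s := r s 0 i - r t 0 i.
have dw i : is_derive t 1 (w i) (v 0 i).
  by rewrite /w; derive_compute; [exact: dr|rewrite subr0].
have wt i : w i t = 0 by rewrite /w subrr.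
(* Corners of a path along the coordinate axes from [r t] to [r s]; the increment of [V] telescopes
   into three single-coordinate increments. *)
pose z1 s := r t + w 0 s *: ev R 0.
pose z2 s := z1 s + w 1 s *: ev R 1.
have cw i : {for t, continuous (fun s => w i s *: ev R i)}.
  apply: cvgZ; [exact: is_derive_continuous (dw i)|exact: cvg_cst].
have c0 : {for t, continuous (fun _ : R => r t)} by exact: cvg_cst.
have c1 : {for t, continuous z1} by apply: cvgD; [exact: cvg_cst|exact: cw].
have c2 : {for t, continuous z2} by apply: cvgD; [exact: c1|exact: cw].
have z1t : z1 t = r t by rewrite /z1 wt scale0r addr0.
have z2t : z2 t = r t by rewrite /z2 wt scale0r addr0.
have z3 s : z2 s + w 2%:R s *: ev R 2%:R = r s.
  apply/rowP => j; rewrite /z2 /z1 /w !mxE.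
  by have [->|->|->] := ord3P j; rewrite /= ?(mulr0, mulr1, addr0) addrC subrK.
have d0 := is_derive_partial _ _ 0 _ _ c0 (wt 0) (dw 0).
have d1 := is_derive_partial _ _ 1 _ _ c1 (wt 1) (dw 1).
have d2 := is_derive_partial _ _ 2%:R _ _ c2 (wt 2%:R) (dw 2%:R).
rewrite z1t in d1; rewrite z2t in d2.
have -> : (fun s => V (r s)) = (fun s => V (r t) + ((V (z1 s) - V (r t)) +
    (V (z2 s) - V (z1 s)) + (V (r s) - V (z2 s)))) by apply/funext => s; ring.
have E2 : (fun s => V (z2 s + w 2%:R s *: ev R 2%:R) - V (z2 s)) =
    (fun s => V (r s) - V (z2 s)) by apply/funext => s; rewrite z3.
rewrite E2 in d2.
notypeclasses refine (is_derive_val _ _ _ _ _ _ _).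
  apply: is_derive_funD (is_derive_funcst _ _ _) (is_derive_funD _ _ _ _ _ _
    (is_derive_funD _ _ _ _ _ _ d0 d1) d2).
by rewrite add0r dotE !mxE.
Qed.

End ChainRule.

(** * The energy balance along the effective equation *)

Section Energy.
Variable R : realType.
Implicit Types (u w y : vec R) (me e eps q : R).

Lemma gammaE u : gamma u = (Num.sqrt (1 - dot u u))^-1.
Proof. by rewrite /gamma enorm_sq. Qed.

Lemma dot_lt1 u : enorm u < 1 -> dot u u < 1.
Proof. by move=> u1; rewrite -enorm_sq -(expr1n R 2) ltr_sqr ?nnegrE ?enorm_ge0. Qed.

Lemma gamma_sq u : enorm u < 1 -> gamma u ^+ 2 = (1 - dot u u)^-1.
Proof.
by move=> /dot_lt1 u1; rewrite gammaE exprVn sqr_sqrtr// subr_ge0 ltW.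
Qed.

(* For [u != 0] the term [|u| phi'(|u|)] in [m_f(u) u] is
   [(1 - |u|^2)^-2 - 3 phi(|u|)]; for [u = 0] both sides vanish. *)
Lemma dot_mm me u y : enorm u < 1 ->
  dot (y *m mm me u) u = dot u y * (gamma u ^+ 3 +
    3 * me * ((1 - dot u u) ^- 2 - 2 * phi (enorm u))).
Proof.
move=> u1; have q1 := dot_lt1 _ u1; have G := gamma_sq _ u1.
rewrite /mm /m0 /mf !mulmxDr -!scalemxAr !mulmxDr -!scalemxAr !mul_mx_scalar.
rewrite mulmx_outer !(dotDl, dotZl) [dot y u]dotC.
have -> : gamma u * dot u y + gamma u ^+ 3 * (dot u y * dot u u) =
    dot u y * gamma u ^+ 3.
  rewrite exprS G; field; apply/eqP; lra.
rewrite [RHS]mulrDr; congr (_ + _).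
have [u0|u0] := eqVneq (enorm u) 0.
  by rewrite (enorm_eq0 _ _ u0) !dotE !mxE; ring.
have up : 0 < enorm u by rewrite lt_def u0 enorm_ge0.
have dphi : derive1 (@phi R) (enorm u) =
    ((1 - enorm u ^+ 2) ^- 2 - 3 * phi (enorm u)) / enorm u.
  have /is_derive_phi[_ <-] : 0 < enorm u < 1 by rewrite up u1.
  by rewrite derive1E.
rewrite dphi -enorm_sq; field.
by rewrite u0 andbT enorm_sq gt_eqF// subr_gt0.
Qed.

(** The longitudinal eigenvalue gamma^4 + 4 |u|^2 gamma^6 of [a(u)], without its constant, as a
    function of q = |u|^2. *)
Definition flux q : R := (1 - q) ^- 2 + 4 * q * (1 - q) ^- 3.

Definition damping e : R := e ^+ 2 / (12 * pi).

Lemma is_derive_flux q : q != 1 ->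
  is_derive q 1 flux (6 * (1 - q) ^- 3 + 12 * q * (1 - q) ^- 4).
Proof.
move=> q1; have q0 : 1 - q != 0 by rewrite subr_eq0 eq_sym.
rewrite /flux; derive_compute; rewrite ?expf_neq0//=.
by field.
Qed.

Lemma gammaX u n : enorm u < 1 -> gamma u ^+ (2 * n) = (1 - dot u u) ^- n.
Proof. by move=> u1; rewrite exprM gamma_sq// exprVn. Qed.

Lemma dot_aa e u w : enorm u < 1 ->
  dot (w *m aa e u) u = damping e * (flux (dot u u) * dot u w).
Proof.
move=> u1; rewrite /aa -scalemxAr mulmxDr -scalemxAr mul_mx_scalar mulmx_outer.
rewrite !(dotDl, dotZl) [dot w u]dotC (gammaX _ 2)// (gammaX _ 3)//.
by rewrite /damping /flux; ring.
Qed.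

Lemma dot_bb e u w : enorm u < 1 ->
  dot (bb e u w) u = 3 * damping e * ((1 - dot u u) ^- 3 * (2 * dot u w ^+ 2 +
    dot w w * dot u u) + 6 * (1 - dot u u) ^- 4 * dot u w ^+ 2 * dot u u).
Proof.
move=> u1; have p0 := pi_gt0 R.
rewrite /bb dotZl !(dotDl, dotZl) [dot w u]dotC (gammaX _ 3)// (gammaX _ 4)//.
rewrite /damping (_ : 3 * (e ^+ 2 / (12 * pi)) = e ^+ 2 / (4 * pi)); last first.
  by move: (pi) p0 => P P0; field; rewrite gt_eqF.
by congr (_ * _); ring.
Qed.

Definition schott_energy me e eps (V : vec R -> R) (r u y : vec R) : R :=
  Ham me V r u - eps * (damping e * (flux (dot u u) * dot u y)).

(** The force and mass terms cancel, and so does the term in [y']. With q = |u|^2 and without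
    [eps * damping], the coefficient of |y|^2 is 3q (1 - q)^-3 - flux(q) = - (1 - q)^-3. That of
    (u.y)^2 is 6 (1 - q)^-3 + 18q (1 - q)^-4 - 2 flux'(q) = - 6 (1 - q)^-4. *)
Lemma is_derive_schott_energy me e eps (V : vec R -> R) (r u y : R -> vec R)
    (t : R) (y' : vec R) :
  (forall i x, derivable V x (ev R i)) -> (forall i, continuous (pd i V)) ->
  enorm (u t) < 1 ->
  is_derive t 1 r (u t) -> is_derive t 1 u (y t) -> is_derive t 1 y y' ->
  y t *m mm me (u t) = - grad V (r t) + eps *: (y' *m aa e (u t))
    + eps *: bb e (u t) (y t) ->
  is_derive t 1 (fun s => schott_energy me e eps V (r s) (u s) (y s))
    (- (eps * damping e * ((1 - dot (u t) (u t)) ^- 3 * dot (y t) (y t) +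
       6 * (1 - dot (u t) (u t)) ^- 4 * dot (u t) (y t) ^+ 2))).
Proof.
move=> dV cV u1 dr du dy eqn; have q1 := dot_lt1 _ u1.
have dq : is_derive t 1 (fun s => dot (u s) (u s)) (2 * dot (u t) (y t)).
  apply: is_derive_val.
    by apply: is_derive_dot => i; apply: is_derive_coord; eassumption.
  by rewrite [dot (y t) _]dotC; ring.
have dp : is_derive t 1 (fun s => dot (u s) (y s)) (dot (y t) (y t) + dot (u t) y').
  by apply: is_derive_dot => i; apply: is_derive_coord.
have dpot := is_derive_potential _ _ dV cV _ _ _ (is_derive_coord _ _ _ _ ^~ dr).
have dflux := is_derive_funcomp _ _ _ _ _ _ (is_derive_flux _ (negbT (lt_eqF q1))) dq.
have dself := is_derive_coulomb_sqrt _ _ _ _ (fun s => dot_ge0 _ (u s)) q1 dq.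
have s0 : 0 < 1 - dot (u t) (u t) by rewrite subr_gt0.
have dsqrt : is_derive t 1 (fun s => Num.sqrt (1 - dot (u s) (u s)))
    ((2 * Num.sqrt (1 - dot (u t) (u t)))^-1 * (0 - 2 * dot (u t) (y t))).
  apply: is_derive_funcomp; first exact: is_derive1_sqrt.
have -> : (fun s => schott_energy me e eps V (r s) (u s) (y s)) =
    (fun s => (Num.sqrt (1 - dot (u s) (u s)))^-1 - 1 +
      3 * me * coulomb (Num.sqrt (dot (u s) (u s))) + V (r s)
      - eps * (damping e * (flux (dot (u s) (u s)) * dot (u s) (y s)))).
  by apply/funext => s; rewrite /schott_energy /Ham EsE gammaE.
derive_compute.
- by rewrite gt_eqF// sqrtr_gt0.
- exact: dsqrt.
- by apply: dself => /dot_eq0 ->; rewrite dotE !mxE; ring.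
- exact: dpot.
- exact: dflux.
- exact: dp.
(* Pairing the equation with the velocity determines the power [P] of the force; once it is
   substituted, a rational identity remains. *)
have := congr1 (fun v => dot v (u t)) eqn; rewrite dot_mm// 2!dotDl 2!dotZl dotNl.
rewrite dot_aa// dot_bb// gammaE /flux.
set q := dot (u t) (u t) in s0 *; set p := dot (u t) (y t).
set S := Num.sqrt (1 - q); set P := dot (grad _ _) _; set A := dot (u t) y'.
have S0 : 0 < S by rewrite sqrtr_gt0.
rewrite /enorm -/q; set F := phi _; set k := damping e.
move=> H.
have -> : P = - (p * (S^-1 ^+ 3 + 3 * me * ((1 - q) ^- 2 - 2 * F)))
   + (eps * (k * (((1 - q) ^- 2 + 4 * q * (1 - q) ^- 3) * A))
   + eps * (3 * k * ((1 - q) ^- 3 * (2 * p ^+ 2 + dot (y t) (y t) * q) +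
      6 * (1 - q) ^- 4 * p ^+ 2 * q))).
  by rewrite H; ring.
by field; apply/andP; split; rewrite gt_eqF.
Qed.

End Energy.

(** * Continuity of the coefficients and of the energy, along an arbitrary filter *)

Section Convergence.
Variables (R : realType) (T : Type) (F : set_system T).
Context {FF : ProperFilter F}.
Implicit Types (u w : T -> vec R).

Lemma cvg_fun_at (g : R -> R) (f : T -> R) (l : R) :
  {for l, continuous g} -> f @ F --> l -> g (f x) @[x --> F] --> g l.
Proof. by move=> cg fl; exact: (cvg_comp f g fl cg). Qed.

Lemma cvg_coord u (u0 : vec R) (i : 'I_3) : u @ F --> u0 -> u x 0 i @[x --> F] --> u0 0 i.
Proof.
move=> /cvgrPdist_le cu; apply/cvgrPdist_le => e /cu; apply: filterS => x.
by apply: le_trans; have := mx_norm_coord _ (u0 - u x) i; rewrite !mxE.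
Qed.

Lemma cvg_coords u (u0 : vec R) : (forall i, u x 0 i @[x --> F] --> u0 0 i) -> u @ F --> u0.
Proof.
move=> cu; apply/cvgrPdist_le => e e0.
have H i : \forall x \near F, `|u0 0 i - u x 0 i| <= e.
  by have /cvgrPdist_le := cu i; apply.
apply: filterS3 (H 0) (H 1) (H 2%:R) => x h0 h1 h2.
rewrite [leLHS]/Num.Def.normr /= mx_normrE; apply: bigmax_le; first exact: ltW.
by move=> [i j] _ /=; rewrite !mxE ord1; have [->|->|->] := ord3P j.
Qed.

Lemma cvg_dot u w (u0 w0 : vec R) : u @ F --> u0 -> w @ F --> w0 ->
  dot (u x) (w x) @[x --> F] --> dot u0 w0.
Proof.
move=> cu cw; rewrite dotE; under eq_fun do rewrite dotE.
by do ![apply: cvgD]; apply: cvgM; apply: cvg_coord.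
Qed.

Lemma cvg_enorm u (u0 : vec R) : u @ F --> u0 -> enorm (u x) @[x --> F] --> enorm u0.
Proof.
move=> cu; apply: (cvg_fun_at Num.sqrt); first exact: sqrt_continuous.
exact: cvg_dot.
Qed.

(** The quadratic bound replaces continuity of the defining formula of [g] at 0, where that formula
    is singular. *)
Lemma cvg_radial (g : R -> R) u (u0 : vec R) :
  (forall s : R, 0 < s < 1 -> {for s, continuous g}) ->
  (forall s : R, 0 <= s <= 1 / 2 -> `|g s - g 0| <= s ^+ 2) ->
  u @ F --> u0 -> enorm u0 < 1 ->
  g (enorm (u x)) @[x --> F] --> g (enorm u0).
Proof.
move=> cg g0 cu u1; have ce := cvg_enorm _ _ cu.
have [u00|u0N] := eqVneq (enorm u0) 0; last first.
  by apply: (cvg_fun_at g) => //; apply: cg; rewrite u1 lt_def u0N enorm_ge0.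
rewrite u00 in ce *; apply/cvgrPdist_le => e e0.
have m0 : 0 < Num.min e (1 / 2) by rewrite lt_min e0; lra.
have /cvgrPdist_le /(_ _ m0) := ce; apply: filterS => x.
rewrite sub0r normrN ger0_norm ?enorm_ge0// le_min => /andP[xe x2].
rewrite distrC (le_trans (g0 _ _)) ?enorm_ge0//.
by have := enorm_ge0 _ (u x); nra.
Qed.

Lemma cvg_coulomb u (u0 : vec R) : u @ F --> u0 -> enorm u0 < 1 ->
  coulomb (enorm (u x)) @[x --> F] --> coulomb (enorm u0).
Proof.
apply: cvg_radial => s.
  by move=> /is_derive_coulomb /is_derive_continuous.
move=> /andP[s0 s2]; have s1 : 0 <= s < 1 by rewrite s0; lra.
rewrite {2}/coulomb eqxx subr0 ger0_norm ?coulomb_ge0//.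
have q4 : s ^+ 2 <= 1 / 4 by nra.
rewrite (le_trans (coulomb_le _ _ s1))// ler_pdivrMr; last by lra.
by rewrite ler_peMr ?sqr_ge0//; lra.
Qed.

Lemma cvg_phi u (u0 : vec R) : u @ F --> u0 -> enorm u0 < 1 ->
  phi (enorm (u x)) @[x --> F] --> phi (enorm u0).
Proof.
apply: cvg_radial => s.
  by move=> /is_derive_phi /is_derive_continuous.
by move=> /phi_near0; rewrite {3}/phi eqxx.
Qed.

Lemma cvg_gamma u (u0 : vec R) : u @ F --> u0 -> enorm u0 < 1 ->
  gamma (u x) @[x --> F] --> gamma u0.
Proof.
move=> cu /dot_lt1 u1; rewrite gammaE; under eq_fun do rewrite gammaE.
apply: cvgV; first by rewrite gt_eqF// sqrtr_gt0 subr_gt0.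
apply: (cvg_fun_at Num.sqrt); first exact: sqrt_continuous.
by apply: cvgB; [exact: cvg_cst|exact: cvg_dot].
Qed.

Lemma cvg_dot_inv u (u0 : vec R) : u @ F --> u0 -> enorm u0 < 1 ->
  (1 - dot (u x) (u x))^-1 @[x --> F] --> (1 - dot u0 u0)^-1.
Proof.
move=> cu /dot_lt1 u1; apply: cvgV; first by rewrite gt_eqF// subr_gt0.
by apply: cvgB; [exact: cvg_cst|exact: cvg_dot].
Qed.

Lemma cvg_exp (f : T -> R) (l : R) n : f @ F --> l -> f x ^+ n @[x --> F] --> l ^+ n.
Proof.
move=> fl; elim: n => [|n IH].
  by rewrite expr0; under eq_fun do rewrite expr0; exact: cvg_cst.
by rewrite exprS; under eq_fun do rewrite exprS; exact: cvgM.
Qed.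

Lemma cvg_schott_energy me e eps (V : vec R -> R) (r u y : T -> vec R)
    (r0 u0 y0 : vec R) : continuous V ->
  r @ F --> r0 -> u @ F --> u0 -> y @ F --> y0 -> enorm u0 < 1 ->
  schott_energy _ me e eps V (r x) (u x) (y x) @[x --> F] -->
    schott_energy _ me e eps V r0 u0 y0.
Proof.
move=> cV cr cu cy u1; rewrite /schott_energy /Ham /flux; under eq_fun do rewrite EsE.
have ci := cvg_dot_inv _ _ cu u1.
rewrite EsE; apply: cvgB; first apply: cvgD; first apply: cvgD.
- by apply: cvgB; [exact: cvg_gamma|exact: cvg_cst].
- by apply: cvgM; [exact: cvg_cst|exact: cvg_coulomb].
- exact: (cvg_comp _ _ cr (cV r0)).
apply: cvgM; first exact: cvg_cst; apply: cvgM; first exact: cvg_cst.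
apply: cvgM; last exact: cvg_dot; rewrite -!exprVn; under eq_fun do rewrite -!exprVn.
apply: cvgD; first exact: cvg_exp.
apply: cvgM; last exact: cvg_exp.
by apply: cvgM; [exact: cvg_cst|exact: cvg_dot].
Qed.

End Convergence.

(** * From the energy to a bound on the speed *)

Section EnergyBarrier.
Variable R : realType.
Implicit Types (me e eps c d : R) (V : vec R -> R).

Lemma m_e_ge0 (rho : vec R -> R) : 0 <= m_e rho.
Proof.
rewrite /m_e divr_ge0// fine_ge0//.
apply: integral_ge0 => x _; apply: integral_ge0 => y _; apply: integral_ge0 => z _.
rewrite lee_fin divr_ge0 ?sqr_ge0// /rhohat_sq mulr_ge0//.
  by rewrite invr_ge0 exprn_ge0// mulr_ge0// pi_ge0.
by rewrite addr_ge0 ?sqr_ge0.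
Qed.

(** The field energy is nonnegative, so a point of the sublevel set satisfies gamma <= B with
    [B = c0 + 2 - m], that is |u|^2 <= 1 - B^-2. For an empty set [sup] is 0. *)
Lemma s0_lt1 me V c0 (m : R) : 0 <= me -> (forall x, m <= V x) -> s0 me V c0 < 1.
Proof.
move=> me0 mV; rewrite /s0; set S := [set s | _].
have [->|/set0P S0] := eqVneq S set0; first by rewrite sup0.
set B := c0 + 2 - m.
have key s : S s -> 0 < B /\ s <= Num.sqrt (1 - (B ^+ 2)^-1).
  move=> [u [r [u1 -> H]]].
  have g0 : 0 < gamma u by rewrite gammaE invr_gt0 sqrtr_gt0 subr_gt0 dot_lt1.
  have gB : gamma u <= B.
    move: H; rewrite /Ham EsE => H; have Vr := mV r.
    have : 0 <= 3 * me * coulomb (enorm u).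
      by rewrite !mulr_ge0// coulomb_ge0// enorm_ge0.
    by rewrite /B; lra.
  have B0 := lt_le_trans g0 gB; split=> //.
  rewrite -[enorm u]ger0_norm ?enorm_ge0// -sqrtr_sqr ler_wsqrtr// enorm_sq.
  have : gamma u ^+ 2 <= B ^+ 2 by rewrite lerXn2r// nnegrE ltW.
  have q1 : 0 < 1 - dot u u by rewrite subr_gt0 dot_lt1.
  by rewrite gamma_sq// invf_ple ?posrE ?exprn_gt0//; lra.
case: S0 => s1 Ss1; have [B0 _] := key _ Ss1.
apply: (@le_lt_trans _ _ (Num.sqrt (1 - (B ^+ 2)^-1))).
  by apply: ge_sup; [exists s1|move=> s /key[]].
rewrite -[ltRHS]sqrtr1 ltr_sqrt// ltrBlDr ltrDl invr_gt0 exprn_gt0//.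
Qed.

Lemma le_s0 me V c0 (r u : vec R) : enorm u < 1 -> Ham me V r u <= c0 + 1 ->
  enorm u <= s0 me V c0.
Proof.
move=> u1 H; apply: ub_le_sup; last by exists u, r.
by exists 1 => _ [v [x [v1 -> _]]]; exact: ltW.
Qed.

Lemma s0_ge0 me V c0 : 0 <= s0 me V c0.
Proof.
rewrite /s0; set S := [set s | _].
have [->|/set0P [s Ss]] := eqVneq S set0; first by rewrite sup0.
apply: (@le_trans _ _ s); first by case: Ss => u [r [_ -> _]]; exact: enorm_ge0.
by apply: ub_le_sup => //; exists 1 => _ [v [x [v1 -> _]]]; exact: ltW.
Qed.

(** The time is the infimum of the set where [g] has reached [c]; continuity puts the infimum into
    that set, and [g 0 < c] makes it positive. *)
Lemma first_hitting_time (g : R -> R) (c t1 : R) : 0 <= t1 ->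
  {within `[0, t1], continuous g} -> g 0 < c -> c <= g t1 ->
  exists2 tau, 0 < tau <= t1 & c <= g tau /\ forall s, 0 <= s < tau -> g s < c.
Proof.
move=> t10 cg g0 gt1; pose A := [set s : R | 0 <= s <= t1 /\ c <= g s].
have A0 : A !=set0 by exists t1; rewrite /A /= t10 lexx.
have Alb : has_lbound A by exists 0 => s [/andP[]].
have hA : has_inf A by [].
set tau := inf A; have tau0 : 0 <= tau by apply: lb_le_inf => // s [/andP[]].
have taut1 : tau <= t1 by apply: ge_inf => //; rewrite /A /= t10 lexx.
have before s : 0 <= s < tau -> g s < c.
  move=> /andP[s0 st]; rewrite ltNge; apply/negP => cs.
  have : tau <= s by apply: ge_inf => //; split=> //; rewrite s0 (le_trans (ltW st)).
  by rewrite leNgt st.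
have gtau : c <= g tau.
  rewrite leNgt; apply/negP => gc.
  have /subspace_continuousP /(_ tau) := cg.
  rewrite /= in_itv /= tau0 taut1 => /(_ isT) /cvgrPdist_lt.
  have e0 : 0 < c - g tau by rewrite subr_gt0.
  move=> /(_ _ e0); rewrite near_withinE => /nbhs_ballP [d /= d0 dP].
  have [s [/andP[s0 st1] cs] sd] := inf_adherent d0 hA.
  have ts : tau <= s by apply: ge_inf => //; split=> //; rewrite s0.
  have : `|g tau - g s| < c - g tau.
    apply: dP; last by rewrite in_itv /= s0 st1.
    by rewrite /ball /= ler0_norm ?subr_le0// opprB ltrBlDl.
  by rewrite ltr_distlC => /andP[_]; rewrite subrKC ltNge cs.
exists tau => //; rewrite taut1 andbT lt_def tau0 andbT.
by apply: contraTneq gtau => ->; rewrite -ltNge.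
Qed.

Lemma le_flux (p q : R) : 0 <= p -> p <= q -> q < 1 -> flux R p <= flux R q.
Proof.
move=> p0 pq q1; rewrite /flux -!exprVn.
have pq1 : (1 - p)^-1 <= (1 - q)^-1 by rewrite lef_pV2 ?posrE; lra.
have pi0 : 0 <= (1 - p)^-1 by rewrite invr_ge0; lra.
apply: lerD; first by rewrite lerXn2r// nnegrE// (le_trans pi0).
apply: ler_pM => //; [by rewrite mulr_ge0|by rewrite exprn_ge0|by rewrite ler_wpM2l|].
by rewrite lerXn2r// nnegrE// (le_trans pi0).
Qed.

Lemma flux_ge0 (q : R) : 0 <= q < 1 -> 0 <= flux R q.
Proof.
move=> /andP[q0 q1]; have i0 : 0 <= (1 - q)^-1 by rewrite invr_ge0; lra.
by rewrite /flux -!exprVn addr_ge0 ?mulr_ge0 ?exprn_ge0.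
Qed.

Lemma damping_ge0 e : 0 <= damping R e.
Proof. by rewrite /damping divr_ge0 ?sqr_ge0// mulr_ge0// pi_ge0. Qed.

Lemma is_sol_right_cvg (f : R -> vec R) (T : \bar R) (t : R) :
  {within [set s : R | 0 <= s /\ (s%:E < T)%E], continuous f} ->
  0 < t -> (t%:E < T)%E -> f @ 0^'+ --> f 0.
Proof.
move=> cf t0 tT.
have : {within `[0, t], continuous f}.
  apply: continuous_subspaceW cf => s /=; rewrite in_itv /= => /andP[s0 st].
  by split=> //; rewrite (le_lt_trans _ tT)// lee_fin.
by move=> /(continuous_within_itvP _ t0)[].
Qed.

(** The mean value theorem asks for derivatives only inside the interval, so at time 0 the right
    limit of the energy is enough. *)
Lemma schott_energy_nonincreasing me e eps V (T : \bar R) (r u y : R -> vec R) (t : R) :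
  (forall i x, derivable V x (ev R i)) -> continuous V ->
  (forall i, continuous (pd i V)) -> 0 <= eps ->
  is_sol (mm me) (aa e) (bb e) (grad V) eps T r u y ->
  0 <= t -> (t%:E < T)%E ->
  schott_energy _ me e eps V (r t) (u t) (y t) <=
    schott_energy _ me e eps V (r 0) (u 0) (y 0).
Proof.
move=> dV cV cdV eps0 [u1 cr cu cy sol] t0 tT.
have [->//|tN0] := eqVneq t 0; have {tN0}tp : 0 < t by rewrite lt_def tN0.
have {}u1 s : 0 <= s <= t -> enorm (u s) < 1.
  by move=> /andP[s0 st]; apply: u1; split=> //; rewrite (le_lt_trans _ tT)// lee_fin.
pose df s := - (eps * damping _ e * ((1 - dot (u s) (u s)) ^- 3 * dot (y s) (y s) +
       6 * (1 - dot (u s) (u s)) ^- 4 * dot (u s) (y s) ^+ 2)).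
pose en s := schott_energy _ me e eps V (r s) (u s) (y s).
have den s : 0 < s <= t -> is_derive s 1 en (df s).
  move=> /andP[s0 st]; have [|rd ud yd [ru uy] eqn] := sol s.
    by split=> //; rewrite (le_lt_trans _ tT)// lee_fin.
  have us : enorm (u s) < 1 by apply: u1; rewrite (ltW s0).
  have dr : is_derive s 1 r (u s) := DeriveDef rd ru.
  have du : is_derive s 1 u (y s) := DeriveDef ud uy.
  have dy : is_derive s 1 y ('D_1 y s) := DeriveDef yd erefl.
  exact (is_derive_schott_energy _ me e eps V r u y s _ dV cdV us dr du dy eqn).
have [||s] := @MVT_segment _ en df 0 t t0.
- by move=> s; rewrite in_itv /= => /andP[s0 st]; apply: den; rewrite s0 ltW.
- apply/continuous_within_itvP => //; split.
  + move=> s; rewrite in_itv /= => /andP[s0 st].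
    by apply: is_derive_continuous; apply: den; rewrite s0 ltW.
  + apply: cvg_schott_energy => //; try exact: is_sol_right_cvg tT.
    by apply: u1; rewrite lexx.
  + apply: cvg_at_left_filter; apply: (is_derive_continuous _ _ _ (df t)).
    by apply: den; rewrite tp lexx.
rewrite in_itv /= subr0 => sI enE.
rewrite -subr_le0 -/(en t) -/(en 0) enE mulr_le0_ge0// /df oppr_le0.
have q1 : 0 < 1 - dot (u s) (u s) by rewrite subr_gt0 dot_lt1// u1.
apply: mulr_ge0; first by rewrite mulr_ge0// damping_ge0.
apply: addr_ge0.
  by rewrite mulr_ge0 ?dot_ge0// invr_ge0 exprn_ge0// ltW.
by rewrite mulr_ge0 ?sqr_ge0// mulr_ge0// invr_ge0 exprn_ge0// ltW.
Qed.

(** By Cauchy-Schwarz and monotonicity of [flux], the Schott term at time 0 and at time [t] has size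
    at most [eps * damping * flux (b^2) * C]. The factor 2 in the smallness condition adds the two,
    and the 1 on its right is the gap between the levels [c0] and [c0 + 1]. *)
Lemma energy_barrier me e eps V c0 C b (T : \bar R) (r u y : R -> vec R) (t : R) :
  (forall i x, derivable V x (ev R i)) -> continuous V ->
  (forall i, continuous (pd i V)) -> 0 <= eps -> b < 1 ->
  is_sol (mm me) (aa e) (bb e) (grad V) eps T r u y ->
  (forall s, 0 <= s -> (s%:E < T)%E -> enorm (u s) <= b /\ enorm (y s) <= C) ->
  Ham me V (r 0) (u 0) <= c0 ->
  eps * (2 * (damping _ e * (flux _ (b ^+ 2) * C))) <= 1 ->
  0 <= t -> (t%:E < T)%E -> enorm (u t) <= s0 me V c0.
Proof.
move=> dV cV cdV eps0 b1 sol bnd H0 small t0 tT.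
have T0 : (0%:E < T)%E by apply: le_lt_trans tT; rewrite lee_fin.
have pbnd s : 0 <= s -> (s%:E < T)%E ->
    `|flux _ (dot (u s) (u s)) * dot (u s) (y s)| <= flux _ (b ^+ 2) * C.
  move=> s0 sT; have [ub yC] := bnd s s0 sT.
  have b0 : 0 <= b by exact: le_trans (enorm_ge0 _ _) ub.
  have qb : dot (u s) (u s) <= b ^+ 2 by rewrite -enorm_sq lerXn2r ?nnegrE ?enorm_ge0.
  have bb1 : b ^+ 2 < 1 by nra.
  rewrite normrM ler_pM//.
    rewrite ger0_norm ?le_flux ?flux_ge0 ?dot_ge0//=.
    exact: le_lt_trans bb1.
  rewrite (le_trans (cauchy_schwarz _ _ _))//.
  rewrite -[C]mul1r ler_pM ?enorm_ge0// (le_trans ub)// ltW//.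
apply: (@le_s0 _ _ _ (r t)).
  by apply: le_lt_trans b1; case: (bnd t t0 tT).
have := schott_energy_nonincreasing me e eps V T r u y t dV cV cdV eps0 sol t0 tT.
rewrite /schott_energy.
have := pbnd t t0 tT; have := pbnd 0 (lexx _) T0.
move: (flux _ (dot (u 0) _) * _) (flux _ (dot (u t) _) * _) => p0 pt.
move: (flux _ _ * C) small => K small; rewrite !ler_norml => /andP[p01 p02] /andP[pt1 pt2].
have k0 := mulr_ge0 eps0 (damping_ge0 e).
move: (damping _ e) small k0 => k small k0; nra.
Qed.

End EnergyBarrier.

(** * Solving the equation for the derivative of [udot] *)

Section Acceleration.
Variable R : realType.
Implicit Types (u v w g : vec R) (me e eps d : R).

Lemma mx_norm_le_enorm v : `|v| <= enorm v.
Proof.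
rewrite [leLHS]/Num.Def.normr /= mx_normrE; apply: bigmax_le => [|[i j] _ /=].
  exact: enorm_ge0.
rewrite ord1 -(@ler_pXn2r _ 2) ?nnegrE ?enorm_ge0// real_normK ?num_real//.
rewrite enorm_sq dotE -!expr2.
by have [->|->|->] := ord3P j; have := sqr_ge0 (v 0 0); have := sqr_ge0 (v 0 1);
  have := sqr_ge0 (v 0 2%:R); lra.
Qed.

(* Inverse of [a(v)], by the Sherman-Morrison formula. *)
Definition inv_aa e v w : vec R :=
  ((damping R e)^-1 * (1 - dot v v) ^+ 2) *:
    (w - (4 / (1 + 3 * dot v v) * dot v w) *: v).

(** The eigenvalue of [aa e v] along [v] is damping (1 + 3|v|^2)(1 - |v|^2)^-3, whence the
    denominator in the rank-one correction. *)
Lemma inv_aaK e v w : e != 0 -> enorm v < 1 -> inv_aa e v w *m aa e v = w.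
Proof.
move=> e0 v1; have q1 := dot_lt1 _ _ v1; have q0 := dot_ge0 _ v.
have k0 : damping R e != 0.
  by rewrite /damping mulf_neq0 ?expf_neq0// invr_neq0// mulf_neq0 ?pnatr_eq0// gt_eqF ?pi_gt0.
rewrite /aa -scalemxAr mulmxDr -scalemxAr mul_mx_scalar mulmx_outer -/(damping R e).
rewrite (gammaX _ _ 2)// (gammaX _ _ 3)// /inv_aa.
move: (damping R e) k0 => k k0; apply/rowP => i; rewrite !mxE !dotE !mxE.
have := q0; have := q1; rewrite !dotE => q1' q0'.
field.
by rewrite k0 /= !gt_eqF//; lra.
Qed.

Definition accel me e eps v w g : vec R :=
  eps^-1 *: inv_aa e v (w *m mm me v + g - eps *: bb e v w).

Lemma accel_eqn me e eps v w g : e != 0 -> eps != 0 -> enorm v < 1 ->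
  w *m mm me v = - g + eps *: (accel me e eps v w g *m aa e v) + eps *: bb e v w.
Proof.
move=> e0 eps0 v1; rewrite /accel -scalemxAl inv_aaK// scalerA mulfV// scale1r.
by rewrite -[RHS]addrA subrK addrC addrK.
Qed.

Lemma clip_id d u : enorm u <= 1 - d -> clip d u = u.
Proof. by rewrite /clip => ->. Qed.

(** A formula without cases and with a positive denominator, from which continuity of the truncation
    can be read off. *)
Lemma clipE d u : 0 < 1 - d ->
  clip d u = ((1 - d) / Num.max (1 - d) (enorm u)) *: u.
Proof.
move=> d1; rewrite /clip; case: leP => // ud.
by rewrite divff ?scale1r// gt_eqF.
Qed.

Lemma enorm_clip_le d u : 0 < 1 - d -> enorm (clip d u) <= 1 - d.
Proof.
move=> d1; rewrite clipE// enormZ; set M := Num.max _ _.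
have M0 : 0 < M by rewrite lt_max d1.
rewrite ger0_norm; last by rewrite divr_ge0// ltW.
rewrite mulrAC ler_pdivrMr// ler_wpM2l//; first exact: ltW.
by rewrite le_max lexx orbT.
Qed.

End Acceleration.

(** * Continuity of the truncation and of the acceleration field *)

Section AccelerationConvergence.
Variables (R : realType) (T : Type) (F : set_system T).
Context {FF : ProperFilter F}.
Implicit Types (v w g : T -> vec R).

Lemma cvg_clip (d : R) v (v0 : vec R) : 0 < 1 - d -> v @ F --> v0 ->
  clip d (v x) @[x --> F] --> clip d v0.
Proof.
move=> d1 cv; rewrite clipE//; under eq_fun do rewrite clipE//.
apply: cvgZ => //; apply: cvgM; first exact: cvg_cst.
apply: cvgV; first by rewrite gt_eqF// lt_max d1.
rewrite maxr_absE; under eq_fun do rewrite maxr_absE.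
have ce : enorm (v x) @[x --> F] --> enorm v0 by exact: cvg_enorm.
apply: cvgM; last exact: cvg_cst; apply: cvgD; first by apply: cvgD; [exact: cvg_cst|exact: ce].
by apply: cvg_norm; apply: cvgB; [exact: cvg_cst|exact: ce].
Qed.

(** With A = |v| phi'(|v|), rewritten by the differential equation for [phi], the vector has length
    at most |A| |w|. At [v0 = 0] the limit of A is 1 - 3 phi(0) = 0, which settles the singular case
    without any derivative of [phi] at 0. *)
Lemma cvg_axial v w (v0 w0 : vec R) : v @ F --> v0 -> w @ F --> w0 -> enorm v0 < 1 ->
  ((enorm (v x))^-1 * derive1 (@phi R) (enorm (v x)) * dot (w x) (v x)) *: v x
    @[x --> F] -->
  ((enorm v0)^-1 * derive1 (@phi R) (enorm v0) * dot w0 v0) *: v0.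
Proof.
move=> cv cw v1.
pose k u : R := (enorm u)^-1 * derive1 (@phi R) (enorm u).
pose A u : R := (1 - dot u u)^-1 ^+ 2 - 3 * phi (enorm u).
have kE u : 0 < enorm u < 1 -> k u = A u / dot u u.
  move=> u01; have up : 0 < enorm u by case/andP: u01.
  have /is_derive_phi[_] := u01; rewrite /k derive1E => ->.
  have q1 : 1 - enorm u ^+ 2 != 0 by case/andP: u01 => _ u1; apply/eqP; nra.
  by rewrite /A -enorm_sq; field; rewrite q1 gt_eqF.
have ce : enorm (v x) @[x --> F] --> enorm v0 by exact: cvg_enorm.
have near1 : \forall x \near F, enorm (v x) < 1 by apply: (cvgr_lt (enorm v0)) v1; exact: ce.
have cA : A (v x) @[x --> F] --> A v0.
  apply: cvgB; first by apply: cvg_exp; exact: cvg_dot_inv.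
  by apply: cvgM; [exact: cvg_cst|exact: cvg_phi].
have [v00|v0N] := eqVneq (enorm v0) 0; last first.
  have vp : 0 < enorm v0 by rewrite lt_def v0N enorm_ge0.
  have near0 : \forall x \near F, 0 < enorm (v x) by apply: (cvgr_gt (enorm v0)) vp; exact: ce.
  apply: cvgZ => //; apply: cvgM; last exact: cvg_dot.
  rewrite -/(k v0) kE ?vp//.
  have : A (v x) / dot (v x) (v x) @[x --> F] --> A v0 / dot v0 v0.
    apply: cvgM => //; apply: cvgV; last exact: cvg_dot.
    by rewrite -enorm_sq expf_neq0.
  apply: cvg_trans; apply: near_eq_cvg; apply: filterS2 near0 near1 => x x0 x1.
  by rewrite -/(k (v x)) kE ?x0.
rewrite (enorm_eq0 _ _ v00) scaler0.
have cB : `|A (v x)| * enorm (w x) @[x --> F] --> 0.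
  have <- : `|A v0| * enorm w0 = 0.
    rewrite /A (enorm_eq0 _ _ v00) /enorm dotE !mxE !mul0r !addr0 sqrtr0 subr0.
    by rewrite /phi eqxx invr1 expr1n mul1r mulfV// subrr normr0 mul0r.
  by apply: cvgM; [exact: cvg_norm|exact: cvg_enorm].
apply/cvgrPdist_le => eps eps0.
have /cvgrPdist_le /(_ _ eps0) Bx := cB.
apply: filterS2 near1 Bx => x x1; rewrite !sub0r !normrN.
rewrite ger0_norm ?mulr_ge0 ?enorm_ge0//; apply: le_trans.
rewrite (le_trans (mx_norm_le_enorm _ _))// enormZ -/(k (v x)).
have [vx0|vxN] := eqVneq (enorm (v x)) 0.
  by rewrite vx0 mulr0 mulr_ge0 ?enorm_ge0.
have vp : 0 < enorm (v x) by rewrite lt_def vxN enorm_ge0.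
rewrite kE ?vp// -enorm_sq.
have -> : `|A (v x) / enorm (v x) ^+ 2 * dot (w x) (v x)| * enorm (v x) =
    `|A (v x)| * (`|dot (w x) (v x)| / enorm (v x)).
  by rewrite !normrM normfV (ger0_norm (sqr_ge0 _)); field.
by rewrite ler_wpM2l// ler_pdivrMr//; exact: cauchy_schwarz.
Qed.

Lemma cvg_accel me e eps v w g (v0 w0 g0 : vec R) :
  v @ F --> v0 -> w @ F --> w0 -> g @ F --> g0 -> enorm v0 < 1 ->
  accel R me e eps (v x) (w x) (g x) @[x --> F] --> accel R me e eps v0 w0 g0.
Proof.
move=> cv cw cg v1.
have cgam n : gamma (v x) ^+ n @[x --> F] --> gamma v0 ^+ n.
  by apply: cvg_exp; exact: cvg_gamma.
have mmE u z : z *m mm me u = gamma u *: z + (gamma u ^+ 3 * dot z u) *: u +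
    (3 * me) *: (phi (enorm u) *: z +
      ((enorm u)^-1 * derive1 (@phi R) (enorm u) * dot z u) *: u).
  rewrite /mm /m0 /mf !mulmxDr -!scalemxAr !mulmxDr -!scalemxAr !mul_mx_scalar.
  by rewrite mulmx_outer !scalerA.
have cmm : w x *m mm me (v x) @[x --> F] --> w0 *m mm me v0.
  rewrite mmE; under eq_fun do rewrite mmE.
  apply: cvgD; first apply: cvgD.
  - by apply: cvgZ => //; exact: (cgam 1).
  - by apply: cvgZ => //; apply: cvgM; [exact: cgam|exact: cvg_dot].
  apply: cvgZ; [exact: cvg_cst|apply: cvgD; last exact: cvg_axial].
  by apply: cvgZ => //; exact: cvg_phi.
have cbb : bb e (v x) (w x) @[x --> F] --> bb e v0 w0.
  have cvw : dot (v x) (w x) @[x --> F] --> dot v0 w0 by exact: cvg_dot.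
  apply: cvgZ; first exact: cvg_cst.
  apply: cvgD; first apply: cvgD.
  - apply: cvgZ => //; apply: cvgM => //.
    by apply: cvgM; [exact: cvg_cst|exact: cgam].
  - by apply: cvgZ => //; apply: cvgM; [exact: cgam|exact: cvg_dot].
  - apply: cvgZ => //; apply: cvgM; last exact: cvg_exp.
    by apply: cvgM; [exact: cvg_cst|exact: cgam].
have cz := cvgB (cvgD cmm cg) (cvgZ (cvg_cst eps) cbb).
apply: cvgZ; first exact: cvg_cst.
have c1 : 1 - dot (v x) (v x) @[x --> F] --> 1 - dot v0 v0.
  by apply: cvgB; [exact: cvg_cst|exact: cvg_dot].
apply: cvgZ; first by apply: cvgM; [exact: cvg_cst|exact: cvg_exp].
apply: cvgB; first exact: cz.
apply: cvgZ => //; apply: cvgM; last by apply: cvg_dot; [|exact: cz].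
apply: cvgM; first exact: cvg_cst.
apply: cvgV; first by rewrite gt_eqF// ltr_wpDr// mulr_ge0// dot_ge0.
apply: cvgD; first exact: cvg_cst.
by apply: cvgM; [exact: cvg_cst|exact: cvg_dot].
Qed.

End AccelerationConvergence.

(** * Compactness and boundedness of the field *)

Section CompactBalls.
Variable R : realType.

Lemma compact_ball_row (n : nat) (x : 'rV[R]_n) (r : R) : compact [set y | `|y - x| <= r].
Proof.
apply: bounded_closed_compact.
  exists (`|x| + r); split; first exact: num_real.
  move=> M xM y /= yx; rewrite -[y](subrK x) (le_trans (ler_normD _ _))//.
  by rewrite (le_trans _ (ltW xM))// addrC lerD2l.
rewrite (_ : [set y | _] = closed_ball_ (fun z => `|z|) x r).
  exact: closed_closed_ball_.
by apply/seteqP; split=> y; rewrite /closed_ball_ /= distrC.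
Qed.

Lemma compact_ball_prod (U W : normedModType R) (x : U * W) (r : R) :
  (forall (a : U) s, compact [set y | `|y - a| <= s]) ->
  (forall (a : W) s, compact [set y | `|y - a| <= s]) ->
  compact [set y | `|y - x| <= r].
Proof.
move=> cU cW; have := compact_setX (cU x.1 r) (cW x.2 r).
congr compact; apply/seteqP; split=> [[a b]|[a b]] /=.
  by rewrite prod_normE /= ge_max => -[-> ->].
by rewrite prod_normE /= ge_max => /andP.
Qed.

Lemma compact_enorm_ball (c : R) : compact [set v : vec R | enorm v <= c].
Proof.
apply: bounded_closed_compact.
  exists c; split; first exact: num_real.
  move=> M cM y /= yc.
  by rewrite (le_trans (mx_norm_le_enorm _ _))// (le_trans yc)// ltW.
rewrite (_ : [set v | _] = @enorm R @^-1` [set s : R | s <= c])//.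
apply: closed_comp; last exact: closed_le.
by move=> v _; apply: (@cvg_enorm R _ (nbhs v) _ id v); exact: cvg_id.
Qed.

(** A continuous image of a compact product of balls; [b < 1] keeps the speeds away from the pole of
    [gamma]. *)
Lemma accel_bounded (me e eps b c K : R) : b < 1 -> exists M : R,
  forall v w g : vec R, enorm v <= b -> enorm w <= c -> `|g| <= K ->
    `|accel R me e eps v w g| <= M.
Proof.
move=> b1.
have cA := compact_setX (compact_setX (compact_enorm_ball b) (compact_enorm_ball c))
  (compact_ball_row 3 0 K).
set A := (X in compact X) in cA.
pose f (x : vec R * vec R * vec R) := accel R me e eps x.1.1 x.1.2 x.2.
have cf : {within A, continuous f}.
  apply: continuous_in_subspaceT => x; rewrite inE => -[[/= xb _] _].
  apply: cvg_accel.
  - exact: (cvg_comp _ _ cvg_fst cvg_fst).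
  - exact: (cvg_comp _ _ cvg_fst cvg_snd).
  - exact: cvg_snd.
  - exact: le_lt_trans b1.
have [M [_ HM]] := compact_bounded (continuous_compact cf cA).
exists (M + 1) => v w g vb wc gK; apply: (HM (M + 1)); first by rewrite ltrDl.
by exists (v, w, g) => //; split; [split|rewrite /= subr0].
Qed.

End CompactBalls.

(** * The truncated flow and its relation to the effective and modified equations *)

Section ClippedFlow.
Variable R : realType.

Lemma is_derive_fst (U W : normedModType R) (f : R -> U * W) (t : R) (v : U * W) :
  is_derive t 1 f v -> is_derive t 1 (fun s => (f s).1) v.1.
Proof.
move=> /is_derive1P H; apply/is_derive1P => e /H; apply: filterS => h.
by apply: le_trans; rewrite prod_normE le_max lexx.
Qed.

Lemma is_derive_snd (U W : normedModType R) (f : R -> U * W) (t : R) (v : U * W) :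
  is_derive t 1 f v -> is_derive t 1 (fun s => (f s).2) v.2.
Proof.
move=> /is_derive1P H; apply/is_derive1P => e /H; apply: filterS => h.
by apply: le_trans; rewrite prod_normE le_max lexx orbT.
Qed.

(* [clip (- C) w] truncates [w] at length [1 + C]. *)
Definition clipped_flow (me e eps d C : R) (V : vec R -> R) (r u y : R -> vec R) : Prop :=
  [/\ continuous r, continuous u, continuous y & forall t : R, 0 < t ->
    [/\ is_derive t 1 r (clip d (u t)), is_derive t 1 u (clip (- C) (y t)) &
      is_derive t 1 y (accel R me e eps (clip d (u t)) (clip (- C) (y t))
        (grad V (r t)))]].

(** Truncating the right-hand sides of the equations for [r] and [u] as well makes the whole field
    bounded and defined everywhere, as the existence theorem requires. *)
Lemma clipped_flow_exists (me e eps d C K : R) (V : vec R -> R) (r0 u0 y0 : vec R) :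
  0 < d < 1 -> 0 <= C -> (forall i, continuous (pd i V)) ->
  (forall i x, `|pd i V x| <= K) ->
  exists r u y, [/\ clipped_flow me e eps d C V r u y, r 0 = r0, u 0 = u0 & y 0 = y0].
Proof.
move=> /andP[d0 d1] C0 cV VK.
have d1' : 0 < 1 - d by lra.
have C1 : 0 < 1 - - C by lra.
have K0 : 0 <= K by exact: le_trans (VK 0 0).
have cgrad : continuous (grad V).
  move=> x; apply: (@cvg_coords R _ (nbhs x) _ (grad V) (grad V x)) => i.
  by rewrite mxE; under eq_fun do rewrite mxE; exact: cV.
have gradK x : `|grad V x| <= K.
  rewrite [leLHS]/Num.Def.normr /= mx_normrE; apply: bigmax_le => // j _.
  by rewrite mxE.
have b1 : 1 - d < 1 by lra.
have [M MP] := accel_bounded R me e eps (1 - d) (1 - - C) K b1.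
pose f (x : vec R * vec R * vec R) : vec R * vec R * vec R :=
  (clip d x.1.2, clip (- C) x.2, accel R me e eps (clip d x.1.2) (clip (- C) x.2) (grad V x.1.1)).
have cf : continuous f.
  move=> x.
  have c1 : clip d z.1.2 @[z --> x] --> clip d x.1.2.
    by apply: cvg_clip => //; exact: (cvg_comp _ _ cvg_fst cvg_snd).
  have c2 : clip (- C) z.2 @[z --> x] --> clip (- C) x.2.
    by apply: cvg_clip => //; exact: cvg_snd.
  have c3 : grad V z.1.1 @[z --> x] --> grad V x.1.1.
    have c11 : z.1.1 @[z --> x] --> x.1.1 by exact: (cvg_comp _ _ cvg_fst cvg_fst).
    exact: (cvg_comp _ _ c11 (cgrad _)).
  have c4 : accel R me e eps (clip d z.1.2) (clip (- C) z.2) (grad V z.1.1) @[z --> x] -->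
      accel R me e eps (clip d x.1.2) (clip (- C) x.2) (grad V x.1.1).
    by apply: cvg_accel => //; rewrite (le_lt_trans (enorm_clip_le _ _ _ _)).
  exact: (cvg_pair (cvg_pair c1 c2) c4).
have fM x : `|f x| <= Num.max (Num.max (1 - d) (1 - - C)) M.
  rewrite !prod_normE /= !ge_max !le_max.
  rewrite (le_trans (mx_norm_le_enorm _ _) (enorm_clip_le _ _ _ d1')) /=.
  rewrite (le_trans (mx_norm_le_enorm _ _) (enorm_clip_le _ _ _ C1)) orbT /=.
  by rewrite MP ?orbT ?enorm_clip_le.
have cE (x : vec R * vec R * vec R) s : compact [set z | `|z - x| <= s].
  apply: compact_ball_prod => [a r|a r]; last exact: compact_ball_row.
  by apply: compact_ball_prod => *; exact: compact_ball_row.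
have [X [X0 cX dX]] := peano_existence _ _ cE f _ (r0, u0, y0) cf fM.
exists (fun s => (X s).1.1), (fun s => (X s).1.2), (fun s => (X s).2).
have cX1 : continuous (fun s => (X s).1).
  by move=> t; exact: (cvg_comp _ _ (cX t) cvg_fst).
split; rewrite ?X0//; split.
- by move=> t; exact: (cvg_comp _ _ (cX1 t) cvg_fst).
- by move=> t; exact: (cvg_comp _ _ (cX1 t) cvg_snd).
- by move=> t; exact: (cvg_comp _ _ (cX t) cvg_snd).
move=> t /dX dXt; split.
- exact: (is_derive_fst _ _ _ _ _ (is_derive_fst _ _ _ _ _ dXt)).
- exact: (is_derive_snd _ _ _ _ _ (is_derive_fst _ _ _ _ _ dXt)).
- exact: (is_derive_snd _ _ _ _ _ dXt).
Qed.

Lemma clipped_flow_sol (me e eps d C : R) (V : vec R -> R) (T : \bar R) (r u y : R -> vec R) :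
  0 < d -> e != 0 -> eps != 0 -> clipped_flow me e eps d C V r u y ->
  (forall s, 0 <= s -> (s%:E < T)%E -> enorm (u s) <= 1 - d /\ enorm (y s) <= 1 + C) ->
  is_sol (mm me) (aa e) (bb e) (grad V) eps T r u y.
Proof.
move=> d0 e0 eps0 [cr cu cy flow] bnd; split.
- by move=> t [t0 /(bnd t t0)[ut _]]; lra.
- by apply: continuous_subspaceT.
- by apply: continuous_subspaceT.
- by apply: continuous_subspaceT.
move=> t [t0 tT]; have [ut yt] := bnd t (ltW t0) tT.
have [] := flow t t0; rewrite (clip_id _ _ _ ut) clip_id ?opprK// => -[rd rE] [ud uE] [yd yE].
have ut1 : enorm (u t) < 1 by lra.
split; [exact rd|exact ud|exact yd|exact (conj rE uE)|].
rewrite yE; exact (accel_eqn _ _ _ _ _ _ _ e0 eps0 ut1).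
Qed.

Lemma is_sol_restrict (M A : vec R -> 'M[R]_3) (B : vec R -> vec R -> vec R)
    (gV : vec R -> vec R) (eps : R) (T T' : \bar R) (r u y : R -> vec R) :
  (T' <= T)%E -> is_sol M A B gV eps T r u y -> is_sol M A B gV eps T' r u y.
Proof.
move=> T'T [u1 cr cu cy sol].
have sub : [set t : R | 0 <= t /\ (t%:E < T')%E] `<=` [set t | 0 <= t /\ (t%:E < T)%E].
  by move=> t [t0 tT']; split=> //; exact: lt_le_trans T'T.
split; [by move=> t /sub/u1|exact: continuous_subspaceW cr|
  exact: continuous_subspaceW cu|exact: continuous_subspaceW cy|].
by move=> t [t0 tT']; apply: sol; split=> //; exact: lt_le_trans T'T.
Qed.

(** This carries an effective solution over to the modified system, to which the invariance of the
    manifold refers. *)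
Lemma is_sol_clip (M A : vec R -> 'M[R]_3) (B : vec R -> vec R -> vec R)
    (gV : vec R -> vec R) (eps d : R) (T : \bar R) (r u y : R -> vec R) :
  (forall s, 0 <= s -> (s%:E < T)%E -> enorm (u s) <= 1 - d) ->
  is_sol M A B gV eps T r u y ->
  is_sol (fun v => M (clip d v)) (fun v => A (clip d v)) (fun v w => B (clip d v) w)
    gV eps T r u y.
Proof.
move=> ud [u1 cr cu cy sol]; split=> // t [t0 tT].
by rewrite clip_id ?ud ?ltW//; apply: sol.
Qed.

Lemma le_left_limit (g : R -> R) (c t : R) : 0 < t -> {for t, continuous g} ->
  (forall s, 0 <= s < t -> g s <= c) -> g t <= c.
Proof.
move=> t0 cg gc; rewrite leNgt; apply/negP => ct.
have ct0 : 0 < g t - c by rewrite subr_gt0.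
move/cvgrPdist_lt/(_ _ ct0): cg => /nbhs_ballP[d /= d0 dP].
pose s := Num.max (t / 2) (t - d / 2).
have st : 0 <= s < t.
  by rewrite le_max gt_max; apply/andP; split; [apply/orP; left|apply/andP; split]; lra.
have : `|g t - g s| < g t - c.
  apply: dP; rewrite /ball /= ger0_norm ?subr_ge0; last by case/andP: st => _ /ltW.
  by rewrite ltrBlDl -ltrBlDr lt_max; apply/orP; right; lra.
by rewrite ltr_distlC => /andP[]; have := gc s st; lra.
Qed.

End ClippedFlow.

(** * Confinement and conclusion *)

(** As long as |u| <= 1 - d the solution also solves the modified system, so it stays on the
    manifold and [y] is bounded by [C]; this bound feeds the energy barrier, which improves [1 - d]
    to [s0]. Both halves of the theorem use it up to a hypothetical exit time. *)
Lemma trapped_until_exit (R : realType) (rho V : vec R -> R) (vbar c0 C eps : R)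
    (h : vec R -> vec R -> vec R) (T : \bar R) (r u y : R -> vec R) :
  let d := dbar (m_e rho) V vbar c0 in
  (forall i x, derivable V x (ev R i)) -> continuous V ->
  (forall i, continuous (pd i V)) -> 0 <= eps -> 0 < d ->
  (forall r u, enorm u <= vbar -> Ham (m_e rho) V r u <= c0) ->
  (forall r u, enorm u < 1 -> enorm (h r u) <= C) ->
  (forall (T : \bar R) (r u y : R -> vec R), mod_sol rho V d eps T r u y ->
     y 0 = h (r 0) (u 0) -> forall t, 0 <= t -> (t%:E < T)%E -> y t = h (r t) (u t)) ->
  eps * (2 * (damping R (rho_int rho) * (flux R ((1 - d) ^+ 2) * C))) <= 1 ->
  eff_sol rho V eps T r u y -> enorm (u 0) <= vbar -> y 0 = h (r 0) (u 0) ->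
  (forall s, 0 <= s -> (s%:E < T)%E -> enorm (u s) <= 1 - d) ->
  forall s, 0 <= s -> (s%:E < T)%E ->
    enorm (u s) <= s0 (m_e rho) V c0 /\ enorm (y s) <= C.
Proof.
move=> d dV cV cdV eps0 d0 Hc hC inv small sol u0 y0 ud.
have yh := inv T r u y (is_sol_clip _ _ _ _ _ _ _ _ _ _ _ ud sol) y0.
have yC s : 0 <= s -> (s%:E < T)%E -> enorm (y s) <= C.
  by move=> s0 sT; rewrite yh//; apply: hC; rewrite (le_lt_trans (ud s _ _))//; lra.
move=> s s0 sT; split; last exact: yC.
have b1 : 1 - d < 1 by lra.
apply: (energy_barrier R _ _ _ _ _ C _ T r u y s dV cV cdV eps0 b1 sol) => //.
- by move=> t t0 tT; split; [exact: ud|exact: yC].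
- exact: Hc.
Qed.

Theorem theorem4p4 (R : realType) (rho V : vec R -> R) (vbar c0 eps0 : R)
    (h : R -> vec R -> vec R -> vec R) :
  (* rho in C_0^infty, radial, e = \int rho <> 0 *)
  smooth3 rho -> compact_support rho -> radial rho -> rho_int rho != 0 ->
  (* V in C^3 satisfying (U) *)
  Ck 3 V ->
  (exists m : R, forall x, m <= V x) ->
  (exists K : R, forall s : seq 'I_3, (size s <= 3)%N -> forall x, `|iter_pd s V x| <= K) ->
  (* vbar < 1 and the choice of c0 *)
  vbar < 1 ->
  (forall r u : vec R, enorm u <= vbar -> Ham (m_e rho) V r u <= c0) ->
  (* the center manifolds I_eps = {(r,u,h eps r u)}, eps in (0, eps0] *)
  0 < eps0 ->
  (forall eps, 0 < eps <= eps0 -> C1_on_ball (h eps)) ->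
  (exists C : R, forall eps r u, 0 < eps <= eps0 -> enorm u < 1 -> enorm (h eps r u) <= C) ->
  (forall eps, 0 < eps <= eps0 ->
     forall (T : \bar R) (r u y : R -> vec R),
       mod_sol rho V (dbar (m_e rho) V vbar c0) eps T r u y ->
       y 0 = h eps (r 0) (u 0) ->
       forall t, 0 <= t -> (t%:E < T)%E -> y t = h eps (r t) (u t)) ->
  exists eps1 : R, 0 < eps1 /\ eps1 <= eps0 /\
    forall eps, 0 < eps <= eps1 ->
      (forall (T : \bar R) (r u y : R -> vec R),
         eff_sol rho V eps T r u y ->
         enorm (u 0) <= vbar -> y 0 = h eps (r 0) (u 0) ->
         forall t, 0 <= t -> (t%:E < T)%E ->
           ~ (enorm (u t) = 1 - dbar (m_e rho) V vbar c0 /\ y t = h eps (r t) (u t)))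
      /\
      (forall r0 u0 : vec R, enorm u0 <= vbar ->
         exists r u y : R -> vec R,
           [/\ eff_sol rho V eps +oo%E r u y, r 0 = r0, u 0 = u0 & y 0 = h eps r0 u0]).
Proof.
move=> _ _ _ e0 V3 [m mV] [K VK] vbar1 Hc0 eps00 _ [C hC] inv.
have dV i x : derivable V x (ev R i) by exact: ((V3 [::] isT).2 isT i x).
have cV : continuous V by exact: ((V3 [::] isT).1).
have cdV i : continuous (pd i V) by exact: ((V3 [:: i] isT).1).
have VK1 i x : `|pd i V x| <= K by exact: (VK [:: i] isT x).
have me0 := m_e_ge0 R rho.
have s01 := s0_lt1 R (m_e rho) V c0 m me0 mV.
have s00 := s0_ge0 R (m_e rho) V c0.
set d := dbar (m_e rho) V vbar c0 in inv *.
(* The halves in [dbar] leave strict gaps: both [vbar] and [s0] lie below [1 - d]. *)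
have [d0 dv ds] : [/\ 0 < d, d <= (1 - vbar) / 2 & d <= (1 - s0 (m_e rho) V c0) / 2].
  by rewrite /d /dbar lt_min !ge_min !lexx orbT; split => //; apply/andP; split; lra.
have C0 : 0 <= C.
  apply: (le_trans (enorm_ge0 _ (h eps0 0 0))); apply: hC; first by rewrite eps00 lexx.
  by rewrite /enorm dotE !mxE !mul0r !addr0 sqrtr0.
set X := 2 * (damping R (rho_int rho) * (flux R ((1 - d) ^+ 2) * C)).
have X0 : 0 <= X.
  have b0 : 0 <= 1 - d by lra.
  apply: mulr_ge0 => //; apply: mulr_ge0; first exact: damping_ge0.
  by apply: mulr_ge0 => //; apply: flux_ge0; rewrite sqr_ge0 /=; nra.
(* The bound 1/(X + 1) gives [eps * X <= 1] and stays meaningful when [X = 0]. *)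
exists (Num.min eps0 (X + 1)^-1); split; last split.
- by rewrite lt_min eps00 invr_gt0; lra.
- by rewrite ge_min lexx.
move=> eps /andP[epsp]; rewrite le_min => /andP[epsle epsX].
have epsI : 0 < eps <= eps0 by rewrite epsp.
have small : eps * X <= 1.
  apply: (@le_trans _ _ ((X + 1)^-1 * X)); first by rewrite ler_wpM2r.
  by rewrite mulrC ler_pdivrMr; lra.
have trapped T r u y := trapped_until_exit R rho V vbar c0 C eps (h eps) T r u y
  dV cV cdV (ltW epsp) d0 Hc0 (fun r u => hC eps r u epsI) (inv eps epsI) small.
split.
  move=> T r u y sol u0 y0 t t0 tT [ut _].
  have [u1 _ cu _ eqs] := sol.
  have [|||tau /andP[tau0 taut] [gtau gbefore]] :=
    @first_hitting_time R (fun s => enorm (u s)) (1 - d) t t0.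
  - have cut : {within `[0, t], continuous u}.
      apply: continuous_subspaceW cu => s /=; rewrite in_itv /= => /andP[s0' st].
      by split=> //; rewrite (le_lt_trans _ tT)// lee_fin.
    move=> s; apply: cvg_enorm; exact: cut.
  - by lra.
  - by rewrite ut.
  have tauT : (tau%:E < T)%E by rewrite (le_lt_trans _ tT)// lee_fin.
  (* The solution is cut at [tau] because |u| <= 1 - d is guaranteed only before that time. *)
  have sol' : eff_sol rho V eps tau%:E r u y.
    by apply: is_sol_restrict sol; exact: ltW.
  have bound s : 0 <= s < tau -> enorm (u s) <= s0 (m_e rho) V c0.
    move=> /andP[s0' st]; case: (trapped _ _ _ _ sol' u0 y0 _ s s0') => //.
    by move=> s' s0'' st'; rewrite ltW// gbefore// s0'' -lte_fin.
  have ctau : {for tau, continuous (fun s => enorm (u s))}.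
    have [|_ ud _ _ _] := eqs tau; first by split.
    have cut : {for tau, continuous u}.
      by apply: differentiable_continuous; exact/derivable1_diffP.
    exact: (@cvg_enorm _ _ (nbhs tau)).
  have := le_left_limit R _ _ _ tau0 ctau bound.
  by lra.
move=> r0 u0 u0v.
have d1 : 0 < d < 1 by rewrite d0; lra.
have [r [u [y [flow r0E u0E y0E]]]] := clipped_flow_exists R (m_e rho) (rho_int rho)
  eps d C K V r0 u0 (h eps r0 u0) d1 C0 cdV VK1.
exists r, u, y; split=> //.
have epsN : eps != 0 by rewrite gt_eqF.
have flow_sol T := clipped_flow_sol R _ _ _ _ _ _ T _ _ _ d0 e0 epsN flow.
have [cr cu cy _] := flow.
(* Negative exactly while both truncations have room to spare, so that a single hitting time
   controls [u] and [y] together. *)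
pose g s := Num.max (enorm (u s) - (1 - d)) (enorm (y s) - (1 + C)).
have ceu : continuous (fun s => enorm (u s)) 
  by move=> s; exact: (@cvg_enorm _ _ (nbhs s) _ u _ (cu s)).
have cey : continuous (fun s => enorm (y s)) 
  by move=> s; exact: (@cvg_enorm _ _ (nbhs s) _ y _ (cy s)).
have cg : continuous g.
  by move=> s; exact: (continuous_max (cvgB (ceu s) (cvg_cst _)) (cvgB (cey s) (cvg_cst _))).
have gE s : g s < 0 -> enorm (u s) <= 1 - d /\ enorm (y s) <= 1 + C.
  by rewrite /g gt_max => /andP[h1 h2]; split; lra.
have u01 : enorm u0 < 1 by lra.
have g_lt0 t : 0 <= t -> g t < 0.
  move=> t0; rewrite ltNge; apply/negP => gt.
  have [||tau /andP[tau0 taut] [gtau gbefore]] := @first_hitting_time R g 0 t t0 _ _ gt.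
  - exact: continuous_subspaceT.
  - rewrite /g gt_max u0E y0E; apply/andP; split; first by lra.
    by have := hC eps r0 u0 epsI u01; lra.
  have sol : eff_sol rho V eps tau%:E r u y.
    apply: flow_sol => s s0' st; apply: gE; apply: gbefore.
    by rewrite s0' -lte_fin.
  have bound s : 0 <= s < tau -> enorm (u s) <= s0 (m_e rho) V c0 /\ enorm (y s) <= C.
    move=> /andP[s0' st]; apply: (trapped _ _ _ _ sol _ _ _ s s0') => //.
    + by rewrite u0E.
    + by rewrite r0E u0E.
    + move=> s' s0'' st'; apply: (gE s' _).1; apply: gbefore.
      by rewrite s0'' -lte_fin.
  (* Passing to the limit at [tau], the margins between [s0] and [1 - d] and between [C] and [1 + C]
     force [g tau < 0]. *)
  have ub := le_left_limit R _ _ _ tau0 (ceu tau) (fun s st => (bound s st).1).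
  have yb := le_left_limit R _ _ _ tau0 (cey tau) (fun s st => (bound s st).2).
  by move: gtau; rewrite /g leNgt gt_max => /negP; apply; apply/andP; split; lra.
by apply: flow_sol => s s0' _; apply: gE; exact: g_lt0.
Qed.
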